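(* Let $X_1,\dots,X_p$ be mutually independent real random variables with continuous distributions (the null hypothesis $H_0$), and let $\hat\xi_{kl}$ ($1\le k\ne l\le p$) be the Chatterjee rank correlations computed from $n$ i.i.d. copies of $(X_1,\dots,X_p)^\top$. Let $T_{np}=\sum_{k\ne l}^{p}\hat\xi_{kl}^2$ (sum over all ordered pairs $(k,l)$, $1\le k\neq l\le p$), $\mu_{np}=\mathrm{E}(T_{np})$, $\sigma_{np}^2=\mathrm{Var}(T_{np})$, and $u_n=\mathrm{E}(\hat\xi_{kl}^2)=\frac{(n-2)(4n-7)}{10(n-1)^2(n+1)}$. Then $\mu_{np}=p(p-1)u_n$ and, for $k\ne l$, $$\mathrm{Cov}(\hat\xi_{kl}^2,\hat\xi_{lk}^2)=\frac{(n-2)(784n^5-8022n^4+27301n^3-24228n^2-5045n-44070)}{50n(n+1)^4(n-1)^5}.$$ Furthermore, $$\sigma_{np}^2=p(p-1)\mathrm{Var}(\hat\xi_{12}^2)+p(p-1)\mathrm{Cov}(\hat\xi_{12}^2,\hat\xi_{21}^2)$$ $$=p(p-1)\,\frac{224n^8-1792n^7+15803n^6-137437n^5+599321n^4-1080523n^3+610212n^2-493848n+1233960}{700n(n+1)^4(n-1)^5}.$$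
   Context: Let $\boldsymbol X_i=(X_{i1},\dots,X_{ip})^\top$, $i=1,\dots,n$, be i.i.d. copies of $\boldsymbol X=(X_1,\dots,X_p)^\top$. For $k\neq l$, rearrange the pairs $(X_{1k},X_{1l}),\dots,(X_{nk},X_{nl})$ as $(X_{(1)k},X^k_{[1]l}),\dots,(X_{(n)k},X^k_{[n]l})$ so that $X_{(1)k}\le\dots\le X_{(n)k}$, and let $R^k_{[i]l}=\sum_{j=1}^n I(X^k_{[j]l}\le X^k_{[i]l})$ be the rank of $X^k_{[i]l}$. The Chatterjee rank correlation (not symmetric in $k,l$) is $$\hat\xi_{kl}=1-\frac{3\sum_{i=1}^{n-1}|R^k_{[i+1]l}-R^k_{[i]l}|}{n^2-1}.$$
   Formalization: The last closed formula for the variance of T_np is proved for n ≥ 4 only, as it is false at n = 2 (true value 0, formula p(p-1)·68/105) and n = 3 (p(p-1)/1024 versus p(p-1)·43/2560); everything else is proved for n ≥ 2, since the denominators vanish at n = 1. *)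

(* Defs.v *)
From mathcomp Require Import all_boot all_order all_algebra.
From mathcomp Require Import all_classical all_reals all_analysis.

Set Implicit Arguments.
Unset Strict Implicit.
Unset Printing Implicit Defensive.

Import Order.TTheory GRing.Theory Num.Theory.
Import numFieldNormedType.Exports.

Local Open Scope classical_set_scope.
Local Open Scope ring_scope.

(* Mutual independence of finitely many random elements: the product rule over
   every subfamily of indices and every choice of measurable sets. *)
Definition mutually_independent (d d' : measure_display)
    (T : measurableType d) (U : measurableType d') (R : realType)
    (P : probability T R) (I : finType) (Y : I -> T -> U) : Prop :=
  forall (J : {set I}) (B : I -> set U), (forall i, measurable (B i)) ->
  (P [set w | forall i, i \in J -> B i (Y i w)] =
   \prod_(i in J) P (Y i @^-1` B i))%E.

(* The random vector (Y_1, ..., Y_p), valued in p-tuples with the product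
   sigma-algebra. *)
Definition rvec (T : Type) (R : realType) (p : nat) (Y : 'I_p -> T -> R) :
    T -> p.-tuple R :=
  fun w => [tuple Y k w | k < p].

Definition identically_distributed (d1 d2 d' : measure_display)
    (T1 : measurableType d1) (T2 : measurableType d2) (U : measurableType d')
    (R : realType) (P1 : probability T1 R) (P2 : probability T2 R)
    (Y1 : T1 -> U) (Y2 : T2 -> U) : Prop :=
  forall B : set U, measurable B -> P1 (Y1 @^-1` B) = P2 (Y2 @^-1` B).

Definition iid_copies (d d0 : measure_display)
    (T : measurableType d) (T0 : measurableType d0) (R : realType)
    (P : probability T R) (P0 : probability T0 R) (n p : nat)
    (S : 'I_n -> 'I_p -> {RV P >-> R}) (X : 'I_p -> {RV P0 >-> R}) : Prop :=
  mutually_independent P (fun i => rvec (S i)) /\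
  forall i, identically_distributed P P0 (rvec (S i)) (rvec X).

Section chatterjee.
Context {R : realType} {n : nat}.
Implicit Types x y : 'I_n -> R.

(* The indices rearranged so that the values of x are nondecreasing; the sort
   is stable, i.e. ties are broken by the original index. *)
Definition sorted_indices x : seq 'I_n :=
  sort (fun i j => x i <= x j) (enum 'I_n).

Definition rank_of y (i : 'I_n) : nat := #|[pred j | y j <= y i]|.

Definition concomitant_ranks x y : seq nat :=
  [seq rank_of y i | i <- sorted_indices x].

(* Positions are counted from 0, so the sum over i = 1, ..., n-1 runs over
   i = 0, ..., n-2. *)
Definition chatterjee x y : R :=
  let r := concomitant_ranks x y in
  1 - (3 * \sum_(0 <= i < n.-1) `|(nth 0%N r i.+1)%:R - (nth 0%N r i)%:R|)
      / (n%:R ^+ 2 - 1).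

End chatterjee.

Definition xi_hat (T : Type) (R : realType) (n p : nat)
    (S : 'I_n -> 'I_p -> T -> R) (k l : 'I_p) : T -> R :=
  fun w => chatterjee (fun i => S i k w) (fun i => S i l w).

Definition T_stat (T : Type) (R : realType) (n p : nat)
    (S : 'I_n -> 'I_p -> T -> R) : T -> R :=
  fun w => \sum_(kl : 'I_p * 'I_p | kl.1 != kl.2) xi_hat S kl.1 kl.2 w ^+ 2.

(* Main.v *)
(** Almost surely no column has ties, and then the rank permutations [s_k] of
    the [p] columns are independent and uniform on ['S_n]: the law of the array
    is unchanged when each column is permuted separately. Without ties [xi_hat k l]
    is a function of [s_k^-1 s_l] only, through the sum of the jumps
    [D(s) = sum_i |s(i+1) - s(i)|], and two terms [xi_kl^2], [xi_ab^2] are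
    uncorrelated unless [{k, l} = {a, b}], because then one of the four indices is
    free and makes one of the two permutations uniform given the other. What is left
    is to compute the means of [D^j], [j <= 4], and of [D(s)^a D(s^-1)^b],
    [a, b <= 2], over ['S_n], as functions of [n].

    Such a product is a sum over points of the permutation graph of factors
    [x' = x + 1] and [|y' - y|]. Grouping the tuples of points by their
    pattern of coincidences, its sum over ['S_n] is the sum over set partitions with
    [k] blocks of [(n - k)! W W'], where [W] and [W'] are sums, over the injective
    placements of the blocks in [{0, ..., n-1}], of products of such factors. Reading the
    positions from left to right gives a finite linear recursion in [n] for [W],
    whose idle part is the identity and whose other part is nilpotent; hence
    [W] is an explicit combination of binomials ['C(n - g, j)], and the
    moment formulas become identities between polynomials with integer
    coefficients, which are checked by computation. *)

From Stdlib Require Import ZArith.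
From HB Require Import structures.
Require Import Defs.
From mathcomp Require Import all_boot all_order all_algebra all_fingroup.
From mathcomp Require Import all_classical all_reals all_analysis.
From mathcomp Require Import measurable_realfun.
From mathcomp Require Import ring zify ssrZ.

Set Implicit Arguments.
Unset Strict Implicit.
Unset Printing Implicit Defensive.

(** * Weighted sums over injective placements *)

Definition env := nat -> nat.
Definition upd (e : env) v a : env := fun u => if u == v then a else e u.

Lemma updC (e : env) u v a b : u != v ->
  upd (upd e u a) v b = upd (upd e v b) u a.
Proof.
move=> uv; apply: funext => w; rewrite /upd.
by case: (eqVneq w v) => // ->; rewrite eq_sym (negbTE uv).
Qed.

Lemma upd_succ (e : env) v a : (succn \o upd e v a) = upd (succn \o e) v a.+1.
Proof. by apply: funext => w; rewrite /upd /=; case: eqP. Qed.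

(* Sum over the injective extensions of [e] to [V] with values in [{0, ..., n-1}]
   that avoid the values in [U]. *)
Fixpoint inj_sum (n : nat) (V U : seq nat) (e : env) (g : env -> nat) : nat :=
  if V is v :: V' then
    \sum_(a < n | nat_of_ord a \notin U) inj_sum n V' (nat_of_ord a :: U) (upd e v a) g
  else g e.

Lemma inj_sum_eq_used n V U U' e g : U =i U' -> inj_sum n V U e g = inj_sum n V U' e g.
Proof.
elim: V U U' e => //= v V IH U U' e eqU.
apply: eq_big => [a|a _]; first by rewrite eqU.
by apply: IH => x; rewrite !inE eqU.
Qed.

Lemma eq_inj_sum n V U e g h : g =1 h -> inj_sum n V U e g = inj_sum n V U e h.
Proof. by move=> gh; congr inj_sum; apply: funext. Qed.

Lemma inj_sum_sum n V U e I (r : seq I) (g : I -> env -> nat) :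
  inj_sum n V U e (fun x => \sum_(i <- r) g i x) = \sum_(i <- r) inj_sum n V U e (g i).
Proof.
elim: V U e => //= v V IH U e.
by rewrite exchange_big; apply: eq_bigr => a _; apply: IH.
Qed.

Lemma inj_sum_scale n V U e c g :
  inj_sum n V U e (fun x => c * g x) = c * inj_sum n V U e g.
Proof.
elim: V U e => //= v V IH U e.
by rewrite big_distrr; apply: eq_bigr => a _; apply: IH.
Qed.

(** Once 0 is used, all remaining vertices sit at positive positions and can be shifted down
    together; [u] keeps its value 0 because it is no longer in [V]. *)
Lemma inj_sum_shift0 n V U e u g : u \notin V ->
  inj_sum n.+1 V (0 :: map succn U) (upd (succn \o e) u 0) g =
  inj_sum n V U e (fun x => g (upd (succn \o x) u 0)).
Proof.
elim: V U e => //= v V IH U e; rewrite inE negb_or => /andP[uv uV].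
rewrite big_mkcond big_ord_recl /= add0n [RHS]big_mkcond /=.
apply: eq_bigr => a _; rewrite /bump /= add1n inE /= mem_map; last exact: succn_inj.
case: ifP => // _; rewrite updC // -upd_succ -(IH (nat_of_ord a :: U)) //.
by apply: inj_sum_eq_used => x; rewrite !inE orbCA.
Qed.

(* Either no vertex sits at position 0, or exactly one vertex [u] does. *)
Lemma inj_sum_shift n V U e g : uniq V ->
  inj_sum n.+1 V (map succn U) (succn \o e) g =
  inj_sum n V U e (fun x => g (succn \o x)) +
  \sum_(u <- V) inj_sum n (rem u V) U e (fun x => g (upd (succn \o x) u 0)).
Proof.
elim: V U e => [|v V IH] U e /=; first by rewrite big_nil addn0.
case/andP=> vV uV; rewrite big_mkcond big_ord_recl /= big_cons eqxx.
have -> /= : 0 \notin map succn U by apply/mapP => -[].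
rewrite inj_sum_shift0 // addnCA; congr addn.
rewrite [X in _ = X + _]big_mkcond /=.
transitivity (\sum_(u <- V) \sum_(a < n | nat_of_ord a \notin U)
     inj_sum n (rem u V) (nat_of_ord a :: U) (upd e v a)
        (fun x => g (upd (succn \o x) u 0)) +
   \sum_(a < n) if nat_of_ord a \notin U then inj_sum n V (nat_of_ord a :: U) (upd e v a)
        (fun x => g (succn \o x)) else 0).
  rewrite exchange_big /= [X in X + _]big_mkcond -big_split /=.
  apply: eq_bigr => a _; rewrite /bump /= add1n mem_map; last exact: succn_inj.
  case: ifP => // _; rewrite -upd_succ addnC.
  by rewrite -(IH (nat_of_ord a :: U) (upd e v a) uV).
rewrite addnC; congr addn; rewrite big_seq [RHS]big_seq; apply: eq_bigr => u uV'.
by rewrite ifN //; apply: contraNneq vV => ->.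
Qed.

(* [Dist u v] is [|x_u - x_v|] and [Next u v] is the indicator of [x_v = x_u + 1];
   [Pos v] and [Zero v] are what they become once [u] has been placed at the origin. *)
Inductive factor := Dist of nat & nat | Pos of nat | Next of nat & nat | Zero of nat.

Definition factor_eqb f1 f2 :=
  match f1, f2 with
  | Dist u v, Dist u' v' => if eqn u u' then eqn v v' else false
  | Pos v, Pos v' => eqn v v'
  | Next u v, Next u' v' => if eqn u u' then eqn v v' else false
  | Zero v, Zero v' => eqn v v'
  | _, _ => false
  end.

Lemma factor_eqbP : Equality.axiom factor_eqb.
Proof.
case=> [u v|v|u v|v] [u' v'|v'|u' v'|v'] /=; rewrite ?eqnE; try by constructor.
- by rewrite -[if _ then _ else _]/(andb _ _); apply: (iffP andP) => [[/eqP-> /eqP->]|[-> ->]].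
- by apply: (iffP eqP) => [->|[->]].
- by rewrite -[if _ then _ else _]/(andb _ _); apply: (iffP andP) => [[/eqP-> /eqP->]|[-> ->]].
- by apply: (iffP eqP) => [->|[->]].
Qed.
HB.instance Definition _ := hasDecEq.Build factor factor_eqbP.

Definition factor_val (e : env) (f : factor) : nat :=
  match f with
  | Dist u v => (e u - e v) + (e v - e u)
  | Pos v => e v
  | Next u v => e v == (e u).+1
  | Zero v => e v == 0
  end.
Definition factor_prod e F := \prod_(f <- F) factor_val e f.
Definition opt_val e o := if o is Some f then factor_val e f else 1.

Definition opt_cons o (F : seq factor) := if o is Some f then f :: F else F.

(* The monomials of a factor after [w] has been placed at position 0 and all other
   positions have been shifted down by one; [None] stands for 1. *)
Definition place_alts w f : seq (option factor) :=
  match f with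
  | Dist u v =>
      if eqn u w then (if eqn v w then [::] else [:: Some (Pos v); None])
      else if eqn v w then [:: Some (Pos u); None] else [:: Some f]
  | Pos v => if eqn v w then [::] else [:: Some f; None]
  | Next u v => if eqn v w then [::] else if eqn u w then [:: Some (Zero v)] else [:: Some f]
  | Zero v => if eqn v w then [:: None] else [::]
  end.

Lemma place_altsP w f e :
  factor_val (upd (succn \o e) w 0) f = \sum_(o <- place_alts w f) opt_val e o.
Proof.
rewrite /upd; case: f => [u v|v|u v|v] /=; rewrite ?eqnE.
- by case: (eqVneq u w); case: (eqVneq v w) => _ _;
    rewrite ?big_cons ?big_nil /= ?subSS ?sub0n ?subn0 //; lia.
- by case: (eqVneq v w) => _; rewrite ?big_cons ?big_nil /= ?addn0 ?addn1.
- by case: (eqVneq v w); case: (eqVneq u w) => _ _;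
    rewrite ?big_cons ?big_nil /= ?eqSS ?addn0.
- by case: (eqVneq v w); rewrite ?big_cons ?big_nil.
Qed.

Fixpoint expand w F : seq (seq factor) :=
  if F is f :: F' then
    let r := expand w F' in
    flatten [seq [seq opt_cons o G | G <- r] | o <- place_alts w f]
  else [:: [::]].

Lemma factor_prod_cons e f F : factor_prod e (f :: F) = factor_val e f * factor_prod e F.
Proof. exact: big_cons. Qed.

Lemma expandP w F e :
  factor_prod (upd (succn \o e) w 0) F = \sum_(G <- expand w F) factor_prod e G.
Proof.
elim: F => [|f F IH] /=; first by rewrite big_seq1 /factor_prod !big_nil.
rewrite factor_prod_cons place_altsP IH big_flatten big_map big_distrl /=.
apply: eq_bigr => o _; rewrite big_map big_distrr /=; apply: eq_bigr => G _.
by case: o => [f'|] /=; rewrite ?factor_prod_cons ?mul1n.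
Qed.

Definition is_zero f := if f is Zero _ then true else false.

(* The monomials other than [F] itself when the first position stays empty. *)
Fixpoint idle_rest F : seq (seq factor) :=
  if F is f :: F' then
    let r := idle_rest F' in
    if f is Pos _ then [seq f :: G | G <- r] ++ F' :: r else [seq f :: G | G <- r]
  else [::].

Lemma idle_restP F e : ~~ has is_zero F ->
  factor_prod (succn \o e) F = factor_prod e F + \sum_(G <- idle_rest F) factor_prod e G.
Proof.
elim: F => [|f F IH] /=; first by rewrite big_nil addn0 /factor_prod !big_nil.
rewrite negb_or => /andP[f0 F0]; rewrite !factor_prod_cons IH //.
have E : \sum_(G <- [seq f :: G | G <- idle_rest F]) factor_prod e G =
   factor_val e f * \sum_(G <- idle_rest F) factor_prod e G.
  by rewrite big_map big_distrr; apply: eq_bigr => G _; rewrite factor_prod_cons.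
case: f f0 E => //= [u v|v|u v] _ E; rewrite ?big_cat ?big_cons /= E ?subSS ?eqSS; lia.
Qed.

Lemma idle_zero F e : has is_zero F -> factor_prod (succn \o e) F = 0.
Proof.
elim: F => //= f F IH; rewrite factor_prod_cons.
by case: f => //= [u v|v|u v] /IH ->; rewrite muln0.
Qed.

(** The base environment is the constant [n], outside the positions: the shift by one turns it into
    the base environment for [n.+1], and the extension [perm_nat] of a permutation fixes it. *)
Definition weight n V F := inj_sum n V [::] (fun=> n) (fun x => factor_prod x F).

Lemma weight0 V F : weight 0 V F = if V is [::] then factor_prod (fun=> 0) F else 0.
Proof. by case: V => //= v V; rewrite /weight /= big_ord0. Qed.

(** Position 0 is either idle, which a [Zero] factor forbids, or holds exactly one vertex [u]; the
    factors are then rewritten in terms of the other positions, shifted down by one. *)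
Lemma weightS n V F : uniq V ->
  weight n.+1 V F =
    (if has is_zero F then 0
     else weight n V F + \sum_(G <- idle_rest F) weight n V G) +
     \sum_(u <- V) \sum_(G <- expand u F) weight n (rem u V) G.
Proof.
move=> uV; rewrite {1}/weight.
rewrite (inj_sum_shift n [::] (fun=> n) (fun x => factor_prod x F) uV).
congr addn; last first.
  apply: eq_bigr => u _; rewrite (eq_inj_sum _ _ _ _ (expandP u F)) inj_sum_sum.
  by [].
case: ifPn => F0.
  rewrite (eq_inj_sum _ _ _ _ (fun e => idle_zero e F0)).
  by rewrite (eq_inj_sum _ _ _ _ (h := fun x => 0 * 0)) // inj_sum_scale.
rewrite (eq_inj_sum _ _ _ _ (fun e => idle_restP e F0)).
rewrite -inj_sum_sum /weight.
transitivity (\sum_(G <- F :: idle_rest F) inj_sum n V [::] (fun=> n) (fun x => factor_prod x G)).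
  by rewrite -inj_sum_sum; apply: eq_inj_sum => e; rewrite big_cons.
by rewrite big_cons inj_sum_sum.
Qed.

Lemma weight_small n V F : uniq V -> n < size V -> weight n V F = 0.
Proof.
elim: n V F => [|n IH] V F uV nV; first by rewrite weight0; case: V nV uV.
rewrite weightS //.
have -> : \sum_(u <- V) \sum_(G <- expand u F) weight n (rem u V) G = 0.
  rewrite big_seq big1 // => u uV'; rewrite big1 // => G _.
  rewrite IH ?rem_uniq // size_rem //.
  by case: (V) nV uV'.
rewrite (IH _ F uV (ltnW nV)); case: ifP => // _.
by rewrite big1 // => G _; exact: (IH _ G uV (ltnW nV)).
Qed.

(** * Newton expansions and the transition step on states *)

Definition newton (a : seq nat) m := \sum_(j < size a) nth 0 a j * 'C(m, j).

Lemma newton0 x a : newton (x :: a) 0 = x.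
Proof.
rewrite /newton big_ord_recl /= muln1 big1 ?addn0 // => j _.
by rewrite bin0n muln0.
Qed.

Lemma newtonS x a m : newton (x :: a) m.+1 = newton (x :: a) m + newton a m.
Proof.
rewrite /newton /= !big_ord_recl /= -addnA -big_split /= !bin0; congr addn.
(* Pascal's rule makes the forward difference drop the leading coefficient, so iterated differences
   list the coefficients one by one. *)
by apply: eq_bigr => j _; rewrite /bump /= add1n binS mulnDr.
Qed.

Fixpoint remove_vertex (u : nat) (V : seq nat) : seq nat :=
  if V is v :: V' then if eqn v u then V' else v :: remove_vertex u V' else [::].

Lemma remove_vertexE u V : remove_vertex u V = rem u V.
Proof. by elim: V => //= v V ->; rewrite eqnE. Qed.

(* [(g, V, F)] stands for the function [m |-> weight (m + g) V F]. The shift [g]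
   absorbs the steps in which a vertex is forced by a [Zero] factor. *)
Definition state := (nat * seq nat * seq factor)%type.
Definition combo := seq (N * state).
Definition state_val m (s : state) := let: (g, V, F) := s in weight (m + g) V F.
Definition combo_val m (c : combo) := \sum_(x <- c) nat_of_bin x.1 * state_val m x.2.

Definition place (g : nat) V F u : seq state :=
  [seq (g, remove_vertex u V, G) | G <- expand u F].

(** With a [Zero] factor the idle term vanishes, so the weight at [m + g.+1] is a sum of weights at
    [m + g]: unfolding lowers the shift and leaves [m] alone. Out of fuel or shift, the state is
    returned as it is, which keeps the sum correct. *)
Fixpoint resolve fuel (s : state) : seq state :=
  let: (g, V, F) := s in
  if fuel is fuel'.+1 then
    if g is g'.+1 then
      if has is_zero F then
        flatten [seq flatten [seq resolve fuel' s' | s' <- place g' V F u] | u <- V]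
      else [:: s]
    else [:: s]
  else [:: s].

(** The forward difference in [m]: all terms of the recursion except the idle copy of [s]. Fuel 4
    covers chains of four [Next] factors, the longest that occur in the tables below; a leftover
    [Zero] would be rejected by [newton_run]. *)
Definition step (s : state) : seq state :=
  let: (g, V, F) := s in
  [seq (g, V, G) | G <- idle_rest F] ++
  flatten [seq flatten [seq resolve 4 s' | s' <- place g V F u] | u <- V].

Definition wf_state (s : state) := uniq s.1.2.

Lemma resolveP fuel s m : wf_state s ->
  \sum_(s' <- resolve fuel s) state_val m s' = state_val m s /\ all wf_state (resolve fuel s).
Proof.
elim: fuel s => [|fuel IH] [[g V] F]; rewrite {1}/wf_state /= => uV.
  by rewrite big_seq1 /= /wf_state uV.
case: g => [|g]; first by rewrite big_seq1 /= /wf_state uV.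
case: ifPn => F0; last by rewrite big_seq1 /= /wf_state uV.
split.
  rewrite big_flatten big_map /= addnS weightS // F0 add0n; apply: eq_bigr => u _.
  rewrite big_flatten !big_map; apply: eq_bigr => G _.
  have wfs : wf_state (g, remove_vertex u V, G) by rewrite /wf_state /= remove_vertexE rem_uniq.
  by rewrite (IH _ wfs).1 /= remove_vertexE.
apply/allP => s' /flatten_mapP[u uV' /flatten_mapP[s'' /mapP[G _ ->]]].
have wfs : wf_state (g, remove_vertex u V, G) by rewrite /wf_state /= remove_vertexE rem_uniq.
exact: (allP (IH _ wfs).2).
Qed.

Lemma stepP s m : wf_state s -> ~~ has is_zero s.2 ->
  state_val m.+1 s = state_val m s + \sum_(s' <- step s) state_val m s' /\ all wf_state (step s).
Proof.
case: s => [[g V] F]; rewrite {1}/wf_state /= => uV F0; split.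
  rewrite addSn weightS // (negbTE F0) -addnA big_cat /= big_map; congr (_ + (_ + _)).
  rewrite big_flatten big_map /=; apply: eq_bigr => u _.
  rewrite big_flatten !big_map; apply: eq_bigr => G _.
  have wfs : wf_state (g, remove_vertex u V, G) by rewrite /wf_state /= remove_vertexE rem_uniq.
  have := esym (resolveP 4 m wfs).1; rewrite {1}/state_val remove_vertexE; exact.
rewrite all_cat; apply/andP; split; first by apply/allP => _ /mapP[G _ ->].
apply/allP => s' /flatten_mapP[u uV' /flatten_mapP[s'' /mapP[G _ ->]]].
have wfs : wf_state (g, remove_vertex u V, G) by rewrite /wf_state /= remove_vertexE rem_uniq.
exact: (allP (resolveP 4 m wfs).2).
Qed.

(** * Renaming of vertices and merging of isomorphic states *)

Definition factor_map (f : nat -> nat) phi :=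
  match phi with
  | Dist u v => Dist (f u) (f v)
  | Pos v => Pos (f v)
  | Next u v => Next (f u) (f v)
  | Zero v => Zero (f v)
  end.

Lemma place_alts_map f w phi : injective f ->
  place_alts (f w) (factor_map f phi) = map (omap (factor_map f)) (place_alts w phi).
Proof.
by move=> fI; case: phi => [u v|v|u v|v] /=; rewrite !eqnE ?(inj_eq fI);
  repeat case: ifP => //=.
Qed.

Lemma expand_map f w F : injective f ->
  expand (f w) (map (factor_map f) F) = map (map (factor_map f)) (expand w F).
Proof.
move=> fI; elim: F => //= phi F IH.
rewrite place_alts_map // map_flatten -map_comp; congr flatten; rewrite -map_comp.
apply: eq_map => o /=; rewrite IH -!map_comp; apply: eq_map => G /=.
by case: o.
Qed.

Lemma idle_rest_map f F :
  idle_rest (map (factor_map f) F) = map (map (factor_map f)) (idle_rest F).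
Proof.
by elim: F => //= phi F ->; case: phi => [u v|v|u v|v] /=;
  rewrite ?map_cat /= -!map_comp.
Qed.

Lemma rem_map (f : nat -> nat) u V : injective f ->
  rem (f u) (map f V) = map f (rem u V).
Proof. by move=> fI; elim: V => //= v V ->; rewrite (inj_eq fI); case: ifP. Qed.

Lemma weight_map f n V F : injective f -> uniq V ->
  weight n (map f V) (map (factor_map f) F) = weight n V F.
Proof.
move=> fI; elim: n V F => [|n IH] V F uV.
  rewrite !weight0; case: V uV => //= _; rewrite /factor_prod big_map.
  by apply: eq_bigr => -[].
rewrite !weightS ?map_inj_uniq //; congr (_ + _).
  have -> : has is_zero (map (factor_map f) F) = has is_zero F.
    by rewrite has_map; apply: eq_has => -[].
  case: ifP => // _; rewrite IH // idle_rest_map big_map; congr (_ + _).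
  by apply: eq_bigr => G _; rewrite IH.
rewrite big_map; apply: eq_bigr => u _; rewrite expand_map // big_map.
by apply: eq_bigr => G _; rewrite rem_map // IH // rem_uniq.
Qed.

(** The recursion [weightS] is symmetric in [V], which avoids exchanging the nested sums of
    [inj_sum]. *)
Lemma weight_perm n V V' F : uniq V -> perm_eq V V' -> weight n V F = weight n V' F.
Proof.
elim: n V V' F => [|n IH] V V' F uV VV'.
  by rewrite !weight0; have := perm_size VV'; case: (V); case: (V').
have uV' : uniq V' by rewrite -(perm_uniq VV').
rewrite !weightS // (perm_big _ VV') /=; congr (_ + _).
  case: ifP => // _; rewrite (IH _ _ _ uV VV'); congr (_ + _).
  by apply: eq_bigr => G _; apply: IH.
apply: eq_bigr => u _; apply: eq_bigr => G _; apply: IH; first exact: rem_uniq.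
by rewrite !rem_filter //; apply: perm_filter.
Qed.

(** Values absent from [l] are sent past its end, so that the map is injective on all of [nat] and
    can serve as a renaming. *)
Fixpoint rank_in (v : nat) (l : seq nat) (i : nat) : nat :=
  if l is w :: l' then if eqn w v then i else rank_in v l' i.+1 else v + i.

Lemma rank_inE v l i :
  rank_in v l i = if v \in l then i + index v l else v + (i + size l).
Proof.
elim: l i => [|w l IH] i /=; first by rewrite addn0.
rewrite eqnE inE eq_sym; case: eqP => /= _; first by rewrite addn0.
by rewrite IH !addSnnS; case: ifP.
Qed.

Lemma rank_in_inj l : injective (fun v => rank_in v l 0).
Proof.
move=> u v; rewrite !rank_inE !add0n.
case: ifP => ul; case: ifP => vl uv.
- by rewrite -(nth_index 0 ul) uv nth_index.
- by have : index u l < size l by [rewrite index_mem]; lia.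
- by have : index v l < size l by [rewrite index_mem]; lia.
- lia.
Qed.

Fixpoint dedup (l : seq nat) : seq nat :=
  if l is v :: l' then v :: seq.filter (fun w => if eqn v w then false else true) (dedup l')
  else [::].

Definition factor_vars f :=
  match f with
  | Dist u v => [:: u; v] | Pos v => [:: v] | Next u v => [:: u; v] | Zero v => [:: v]
  end.

(* Renames the vertices by order of appearance, so that isomorphic states are merged;
   this only serves to keep the computation small. *)
Definition normalize (s : state) : state :=
  let: (g, V, F) := s in
  let F1 := seq.filter (fun f => if f is Pos _ then false else true) F ++
            seq.filter (fun f => if f is Pos _ then true else false) F in
  let l := dedup (flatten (map factor_vars F1) ++ V) in
  let k := size V in
  if all (fun v => PeanoNat.Nat.ltb (rank_in v l 0) k) V then
    (g, iota 0 k, map (factor_map (fun v => rank_in v l 0)) F1)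
  else s.

Lemma normalizeP m s : wf_state s ->
  state_val m (normalize s) = state_val m s /\ wf_state (normalize s).
Proof.
case: s => [[g V] F]; rewrite {1}/wf_state /= => uV.
set F1 := seq.filter _ F ++ _; set l := dedup _; case: ifP => // /allP Vk.
split; last by rewrite /wf_state /= iota_uniq.
have F1F : perm_eq F1 F.
  rewrite /F1; set a := fun f => if f is Pos _ then false else true.
  have Ea : (fun f => if f is Pos _ then true else false) =1 predC a by case.
  by rewrite (eq_filter Ea); apply/permPl/perm_filterC.
have E : weight (m + g) V F = weight (m + g) V F1.
  by rewrite /weight; apply: eq_inj_sum => x; rewrite /factor_prod (perm_big _ F1F).
rewrite /= E -(weight_map (m + g) F1 (@rank_in_inj l) uV); symmetry; apply: weight_perm.
  by rewrite map_inj_uniq //; apply: rank_in_inj.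
apply: uniq_perm; rewrite ?iota_uniq ?map_inj_uniq //; first exact: rank_in_inj.
have uf : uniq (map (fun v => rank_in v l 0) V).
  by rewrite map_inj_uniq //; apply: rank_in_inj.
(* [V] is sent injectively into an interval of [size V] numbers, hence onto it. *)
apply: (uniq_min_size uf _ _).2; last by rewrite size_map size_iota.
move=> _ /mapP[v vV ->]; rewrite mem_iota add0n /=.
by have := Vk v vV; rewrite /is_true PeanoNat.Nat.ltb_lt => /ltP.
Qed.

(* Keyed by [state_key]; a bucket holds the states that share a key, which need not be
   injective. *)
Inductive trie := Leaf | Node of trie & combo & trie.

Fixpoint list_eqb T (e : T -> T -> bool) (s t : seq T) : bool :=
  match s, t with
  | [::], [::] => true
  | x :: s', y :: t' => if e x y then list_eqb e s' t' else false
  | _, _ => false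
  end.

Definition state_eqb (s t : state) : bool :=
  let: (g, V, F) := s in let: (g', V', F') := t in
  if eqn g g' then if list_eqb eqn V V' then list_eqb factor_eqb F F' else false
  else false.

Lemma list_eqb_eq (T : eqType) (s t : seq T) : list_eqb eq_op s t -> s = t.
Proof.
elim: s t => [|x s IH] [|y t] //=.
by case: eqP => // -> /IH ->.
Qed.

Lemma state_eqb_eq s t : state_eqb s t -> s = t.
Proof.
case: s t => [[g V] F] [[g' V'] F'] /=; rewrite eqnE; case: eqP => // ->.
case: ifP => // VV; have -> := @list_eqb_eq nat _ _ VV.
by move=> /(@list_eqb_eq factor) ->.
Qed.

Fixpoint bucket_add (x : N * state) (c : combo) : combo :=
  if c is y :: c' then
    if state_eqb x.2 y.2 then (N.add x.1 y.1, y.2) :: c' else y :: bucket_add x c'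
  else [:: x].

Fixpoint trie_add (k : positive) x t :=
  match t, k with
  | Leaf, xH => Node Leaf [:: x] Leaf
  | Leaf, xO k' => Node (trie_add k' x Leaf) [::] Leaf
  | Leaf, xI k' => Node Leaf [::] (trie_add k' x Leaf)
  | Node l c r, xH => Node l (bucket_add x c) r
  | Node l c r, xO k' => Node (trie_add k' x l) c r
  | Node l c r, xI k' => Node l c (trie_add k' x r)
  end.

Fixpoint trie_elems t (acc : combo) : combo :=
  if t is Node l c r then trie_elems l (c ++ trie_elems r acc) else acc.

Lemma trie_elems_cat t acc : trie_elems t acc = trie_elems t [::] ++ acc.
Proof.
elim: t acc => //= l IHl c r IHr acc.
by rewrite IHl IHr [in RHS]IHl -!catA.
Qed.

Lemma combo_val_cons m x c :
  combo_val m (x :: c) = nat_of_bin x.1 * state_val m x.2 + combo_val m c.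
Proof. exact: big_cons. Qed.

Lemma combo_val_cat m c c' : combo_val m (c ++ c') = combo_val m c + combo_val m c'.
Proof. exact: big_cat. Qed.

Lemma combo_val_bucket m x c : combo_val m (bucket_add x c) = combo_val m (x :: c).
Proof.
elim: c => //= y c IH; case: ifP => [/state_eqb_eq E|_];
  rewrite !combo_val_cons /= ?IH ?combo_val_cons.
  rewrite E; lia.
by rewrite addnCA.
Qed.

Lemma combo_val_trie m k x t : combo_val m (trie_elems (trie_add k x t) [::]) =
  nat_of_bin x.1 * state_val m x.2 + combo_val m (trie_elems t [::]).
Proof.
elim: k t => [k IH|k IH|] [|l c r] /=; rewrite ?combo_val_cons //.
- by rewrite trie_elems_cat [in RHS]trie_elems_cat !combo_val_cat IH; lia.
- by rewrite trie_elems_cat [in RHS]trie_elems_cat !combo_val_cat IH; lia.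
- by rewrite trie_elems_cat [in RHS]trie_elems_cat !combo_val_cat
    combo_val_bucket combo_val_cons; lia.
Qed.

Fixpoint push_unary (v : nat) (p : positive) : positive :=
  if v is v'.+1 then xO (push_unary v' p) else xI p.
Definition push_factor f p :=
  match f with
  | Dist u v => xO (xO (push_unary u (push_unary v p)))
  | Pos v => xO (xI (push_unary v p))
  | Next u v => xI (xO (push_unary u (push_unary v p)))
  | Zero v => xI (xI (push_unary v p))
  end.
Definition state_key (s : state) : positive :=
  foldr push_factor (foldr push_unary xH s.1.2) s.2.

Definition add_steps t (x : N * state) : trie :=
  foldl (fun t s => let s' := normalize s in trie_add (state_key s') (x.1, s') t) t (step x.2).

Definition next_combo (c : combo) : combo := trie_elems (foldl add_steps Leaf c) [::].

(** * Evaluation of weights and of their Newton coefficients *)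

Fixpoint weight_eval n V F : nat :=
  if n < size V then 0 else
  if V is [::] then foldr (fun f r => factor_val (fun=> n) f * r) 1 F else
  if n is n'.+1 then
    (if has is_zero F then 0 else
      weight_eval n' V F + sumn [seq weight_eval n' V G | G <- idle_rest F]) +
    sumn [seq sumn [seq weight_eval n' (rem u V) G | G <- expand u F] | u <- V]
  else 0.

Definition layer_value (c : combo) : N :=
  foldr (fun x : N * state => let: (a, (g, V, F)) := x in
           N.add (N.mul a (bin_of_nat (weight_eval g V F)))) N0 c.

(* The [j]-th coefficient is the value at [m = 0] of the combination reached after [j]
   non-idle steps; [None] means that the fuel was insufficient or that a forced
   placement was left unresolved. *)
Fixpoint newton_run fuel (c : combo) : option (seq N) :=
  if c is [::] then Some [::] else
  if fuel is fuel'.+1 then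
    if has (fun x : N * state => has is_zero x.2.2) c then None else
    if newton_run fuel' (next_combo c) is Some r then
      Some (layer_value c :: r)
    else None
  else None.

Lemma factor_prod_foldr e F : factor_prod e F = foldr (fun f r => factor_val e f * r) 1 F.
Proof. by elim: F => [|f F IH] /=; rewrite /factor_prod ?big_nil // big_cons -IH. Qed.

Lemma weight_evalP n V F : uniq V -> weight_eval n V F = weight n V F.
Proof.
elim: n V F => [|n IH] V F uV /=; case: ifPn => [nV|_]; try by rewrite weight_small.
- by rewrite weight0; case: V uV => //= _; rewrite factor_prod_foldr.
- case: V uV => [_|v V uV]; first by rewrite /weight /= factor_prod_foldr.
  rewrite weightS // IH //; congr (_ + _).
    case: ifP => // _; congr (_ + _); rewrite sumnE big_map.
    by apply: eq_bigr => G _; rewrite IH.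
  rewrite sumnE big_map; apply: eq_bigr => u _; rewrite sumnE big_map.
  by apply: eq_bigr => G _; rewrite IH // rem_uniq.
Qed.

Definition wf_combo (c : combo) := all (fun x => wf_state x.2) c.

Lemma wf_combo_bucket x c : wf_state x.2 -> wf_combo c -> wf_combo (bucket_add x c).
Proof.
move=> wx; elim: c => /= [|y c IH]; first by rewrite wx.
by case/andP=> wy wc; case: ifP => /= _; rewrite wy //= IH.
Qed.

Lemma wf_combo_trie k x t : wf_state x.2 -> wf_combo (trie_elems t [::]) ->
  wf_combo (trie_elems (trie_add k x t) [::]).
Proof.
rewrite /wf_combo => wx; elim: k t => [k IH|k IH|] [|l c r] /=; rewrite ?wx //.
- by move=> _; apply: IH.
- rewrite trie_elems_cat [X in _ -> all _ X]trie_elems_cat !all_cat.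
  by move=> /and3P[-> -> H] /=; exact: IH.
- by move=> _; apply: IH.
- rewrite trie_elems_cat [X in _ -> all _ X]trie_elems_cat !all_cat.
  by move=> /and3P[H -> ->]; rewrite !andbT; exact: IH.
- rewrite trie_elems_cat [X in _ -> all _ X]trie_elems_cat !all_cat.
  by move=> /and3P[-> H ->] /=; rewrite andbT; exact: wf_combo_bucket.
Qed.

Lemma combo_val_add_steps m t x : all wf_state (step x.2) ->
  combo_val m (trie_elems (add_steps t x) [::]) =
    combo_val m (trie_elems t [::]) + nat_of_bin x.1 * \sum_(s <- step x.2) state_val m s.
Proof.
rewrite /add_steps; elim: (step x.2) t => [|s r IH] t /=.
  by rewrite big_nil muln0 addn0.
case/andP=> ws wr; rewrite IH // combo_val_trie big_cons (normalizeP m ws).1 /=; lia.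
Qed.

Lemma wf_combo_add_steps t x : wf_state x.2 -> ~~ has is_zero x.2.2 ->
  wf_combo (trie_elems t [::]) ->
  wf_combo (trie_elems (add_steps t x) [::]).
Proof.
move=> wx zx; have [_] := stepP 0 wx zx; rewrite /add_steps.
elim: (step x.2) t => [|s r IH] t //= /andP[ws wr] wt.
by apply: IH => //; apply: wf_combo_trie => //; exact: (normalizeP 0 ws).2.
Qed.

Lemma next_comboP m c : wf_combo c -> ~~ has (fun x : N * state => has is_zero x.2.2) c ->
  combo_val m.+1 c = combo_val m c + combo_val m (next_combo c) /\ wf_combo (next_combo c).
Proof.
move=> wc zc; rewrite /next_combo; split.
  suff H t : combo_val m.+1 c + combo_val m (trie_elems t [::]) =
      combo_val m c + combo_val m (trie_elems (foldl add_steps t c) [::]).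
    by have := H Leaf; rewrite /= {2}/combo_val big_nil addn0.
  elim: c t wc zc => [|x c IH] t /=; first by rewrite /combo_val !big_nil.
  case/andP=> wx wc; rewrite negb_or => /andP[zx zc].
  have := IH (add_steps t x) wc zc.
  rewrite !combo_val_cons combo_val_add_steps ?(stepP m wx zx).2 //.
  by rewrite (stepP m wx zx).1 mulnDr; lia.
suff H t : wf_combo (trie_elems t [::]) ->
    wf_combo (trie_elems (foldl add_steps t c) [::]) by apply: H.
elim: c t wc zc => [|x c IH] t //= /andP[wx wc].
rewrite negb_or => /andP[zx zc] wt; apply: IH => //; exact: wf_combo_add_steps.
Qed.

Lemma layer_valueP c : wf_combo c -> nat_of_bin (layer_value c) = combo_val 0 c.
Proof.
elim: c => [|[a [[g V] F]] c IH] /=; first by rewrite /combo_val big_nil.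
case/andP=> wx wc; rewrite combo_val_cons -(IH wc) /= add0n -weight_evalP //; lia.
Qed.

Lemma newton_runS fuel c : newton_run fuel.+1 c =
  if c is [::] then Some [::] else
  if has (fun x : N * state => has is_zero x.2.2) c then None else
  if newton_run fuel (next_combo c) is Some r then Some (layer_value c :: r) else None.
Proof. by case: c. Qed.

(** Both sides have the same value at 0, and the same forward difference by induction on the fuel,
    so they agree for every [m]. *)
Lemma newton_runP fuel c r : wf_combo c -> newton_run fuel c = Some r ->
  forall m, combo_val m c = newton (map nat_of_bin r) m.
Proof.
have nilP : forall m, combo_val m [::] = newton [::] m.
  by move=> m; rewrite /combo_val /newton big_nil big_ord0.
elim: fuel c r => [|fuel IH] c r wc; first by case: c wc => // _ [<-].
rewrite newton_runS; case Ec: {1}c => [|x c0]; first by move=> [<-]; rewrite Ec.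
case: ifPn => // zc.
have [_ wn] := next_comboP 0 wc zc.
case E: (newton_run _ _) => [r'|] // [<-].
elim=> [|m IHm]; first by rewrite [map _ _]/= newton0 layer_valueP.
by rewrite (next_comboP m wc zc).1 IHm [map _ _]/= newtonS (IH _ _ wn E).
Qed.

(** Each [Next] factor can force one placement, so their number is the initial shift [g], and the
    expansion is in [n - g]. The fuel 30 only has to exceed the number of non-idle steps. *)
Definition compile V F : option (nat * seq N) :=
  let g := count (fun f => if f is Next _ _ then true else false) F in
  if newton_run 30 [:: (1%num, (g, V, F))] is Some r then Some (g, r) else None.

Lemma compileP V F g r n : uniq V -> compile V F = Some (g, r) -> g <= n ->
  weight n V F = newton (map nat_of_bin r) (n - g).
Proof.
rewrite /compile => uV; case E: (newton_run _ _) => [r'|] // [<- <-] gn.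
have wc : wf_combo [:: (1%num, ((count (fun f => if f is Next _ _ then true else false) F), V, F))].
  by rewrite /wf_combo /= andbT.
rewrite -(newton_runP wc E) /combo_val big_seq1 /= mul1n subnK //.
Qed.

Definition degenerate f :=
  match f with Dist u v => eqn u v | Next u v => eqn u v | _ => false end.

(** Merging the two ends of an edge produces [|x - x|] or the indicator of [x = x + 1], both zero;
    such patterns are skipped in the tables. *)
Lemma weight_degenerate n V F : has degenerate F -> weight n V F = 0.
Proof.
move=> /hasP[f fF df]; rewrite /weight.
rewrite (@eq_inj_sum _ _ _ _ _ (fun x => 0 * 0)) ?inj_sum_scale // => x.
rewrite /factor_prod (big_rem f fF) /=.
by case: f df {fF} => //= u v; rewrite eqnE => /eqP ->; rewrite ?subnn // eqn_leq ltnn andbF.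
Qed.

Lemma inj_sum_ext n V U e g h :
  (forall x, (forall u, u \notin V -> x u = e u) -> g x = h x) ->
  inj_sum n V U e g = inj_sum n V U e h.
Proof.
elim: V U e => [|v V IH] U e gh /=; first exact: gh.
apply: eq_bigr => a _; apply: IH => x xe; apply: gh => u.
rewrite inE negb_or => /andP[uv uV]; rewrite xe // /upd (negbTE uv) //.
Qed.

(** * Sums over permutations *)

(* A further point [p] is new, or coincides with a placed vertex, or hits [U]. *)
Lemma inj_sum_split n V U e p (K : env -> nat) : uniq V -> p \notin V ->
  inj_sum n V U e (fun x => \sum_(a < n) K (upd x p a)) =
  inj_sum n (rcons V p) U e K +
  \sum_(q <- V) inj_sum n V U e (fun x => K (upd x p (x q))) +
  \sum_(a < n | nat_of_ord a \in U) inj_sum n V U e (fun x => K (upd x p a)).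
Proof.
elim: V U e => [|v V IH] U e /=.
  by rewrite big_nil addn0 (bigID (fun a : 'I_n => nat_of_ord a \in U)) addnC.
case/andP=> vV uV; rewrite inE negb_or => /andP[pv pV].
transitivity (\sum_(b < n | nat_of_ord b \notin U)
  (inj_sum n (rcons V p) (nat_of_ord b :: U) (upd e v b) K +
   \sum_(q <- v :: V) inj_sum n V (nat_of_ord b :: U) (upd e v b) (fun x => K (upd x p (x q))) +
   \sum_(a < n | nat_of_ord a \in U)
     inj_sum n V (nat_of_ord b :: U) (upd e v b) (fun x => K (upd x p a)))).
  apply: eq_bigr => b bU; rewrite IH // big_cons -!addnA; congr (_ + _).
  rewrite [in RHS]addnCA; congr (_ + _).
  rewrite (bigD1 b) /=; last by rewrite inE eqxx.
  congr (_ + _).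
    apply: inj_sum_ext => x xe; congr K; congr upd.
    by rewrite xe // /upd eqxx.
  apply: eq_bigl => a; rewrite inE -val_eqE /=.
  case: (eqVneq (a : nat) b) => [->|]; rewrite ?(negbTE bU) ?andbT //.
rewrite !big_split /=; congr (_ + _ + _); last by rewrite exchange_big.
by rewrite exchange_big.
Qed.

Fixpoint full_sum n (ps : seq nat) (e : env) (G : env -> nat) : nat :=
  if ps is p :: ps' then \sum_(a < n) full_sum n ps' (upd e p a) G else G e.

Lemma full_sum_ext n ps e g h :
  (forall x, (forall u, u \notin ps -> x u = e u) -> g x = h x) ->
  full_sum n ps e g = full_sum n ps e h.
Proof.
elim: ps e => [|v V IH] e gh /=; first exact: gh.
apply: eq_bigr => a _; apply: IH => x xe; apply: gh => u.
rewrite inE negb_or => /andP[uv uV]; rewrite xe // /upd (negbTE uv) //.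
Qed.

Lemma full_sum_scale n ps e c g :
  full_sum n ps e (fun x => c * g x) = c * full_sum n ps e g.
Proof.
elim: ps e => //= v V IH e.
by rewrite big_distrr; apply: eq_bigr => a _; apply: IH.
Qed.

Lemma full_sum_sum n ps e I (r : seq I) (g : I -> env -> nat) :
  full_sum n ps e (fun x => \sum_(i <- r) g i x) = \sum_(i <- r) full_sum n ps e (g i).
Proof.
elim: ps e => //= v V IH e.
by rewrite exchange_big; apply: eq_bigr => a _; apply: IH.
Qed.

Lemma full_sum_upd n ps x p q (G : env -> nat) : p \notin ps -> q \notin ps ->
  full_sum n ps (upd x p (x q)) G = full_sum n ps x (fun e => G (upd e p (e q))).
Proof.
elim: ps x => //= v ps IH x; rewrite !inE !negb_or => /andP[pv pps] /andP[qv qps].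
apply: eq_bigr => a _; rewrite updC // -IH //; congr full_sum; congr upd.
by rewrite /upd (negbTE qv).
Qed.

Definition rename p q u : nat := if eqn u p then q else u.
Definition rename_factor p q f :=
  match f with
  | Dist u v => Dist (rename p q u) (rename p q v)
  | Pos v => Pos (rename p q v)
  | Next u v => Next (rename p q u) (rename p q v)
  | Zero v => Zero (rename p q v)
  end.

Lemma factor_prod_rename x p q F :
  factor_prod (upd x p (x q)) F = factor_prod x (map (rename_factor p q) F).
Proof.
rewrite /factor_prod big_map; apply: eq_bigr => f _.
have E u : upd x p (x q) u = x (rename p q u) by rewrite /upd /rename eqnE; case: ifP.
by case: f => [u v|v|u v|v] /=; rewrite !E.
Qed.

(* All ways to identify the points [ps] with each other and with the vertices [V]. *)
Fixpoint merges (V ps : seq nat) (F F' : seq factor) :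
    seq (seq nat * seq factor * seq factor) :=
  if ps is p :: ps' then
    merges (rcons V p) ps' F F' ++
    flatten [seq merges V ps' (map (rename_factor p q) F) (map (rename_factor p q) F')
            | q <- V]
  else [:: (V, F, F')].

Definition perm_nat n (s : 'S_n) (a : nat) : nat :=
  if insub a is Some i then nat_of_ord (s i) else a.

Lemma perm_nat_ord n (s : 'S_n) (i : 'I_n) : perm_nat s i = s i.
Proof. by rewrite /perm_nat valK. Qed.

Definition joint n F F' (x : env) :=
  \sum_(s : 'S_n) factor_prod x F * factor_prod (perm_nat s \o x) F'.

Lemma joint_rename n F F' x p q :
  joint n F F' (upd x p (x q)) =
  joint n (map (rename_factor p q) F) (map (rename_factor p q) F') x.
Proof.
apply: eq_bigr => s _; rewrite -!factor_prod_rename; congr (_ * factor_prod _ _).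
by apply: funext => u; rewrite /upd /=; case: ifP.
Qed.

(** Points are treated one at a time: a new point becomes a vertex, and a coincidence with a vertex
    is moved into the factors by renaming. *)
Lemma mergesP n V ps F F' e : uniq (V ++ ps) ->
  inj_sum n V [::] e (fun x => full_sum n ps x (joint n F F')) =
  \sum_(r <- merges V ps F F') inj_sum n r.1.1 [::] e (joint n r.1.2 r.2).
Proof.
elim: ps V F F' => [|p ps IH] V F F' /=; first by rewrite big_seq1.
rewrite -cat_rcons => up.
have up' := up; move: up'; rewrite cat_uniq rcons_uniq => /and3P[/andP[pV uV] Vps ups].
have pps : p \notin ps.
  by apply: contraNN Vps => pp; apply/hasP; exists p => //=; rewrite mem_rcons inE eqxx.
rewrite (inj_sum_split n [::] e (fun x => full_sum n ps x (joint n F F')) uV pV).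
rewrite [X in _ + X]big_pred0_eq addn0 big_cat /= IH //; congr addn.
rewrite big_flatten big_map big_seq [RHS]big_seq; apply: eq_bigr => q qV.
rewrite -IH; last first.
  move: up; rewrite -cats1 -catA /= uniq_catC /= => /andP[_].
  by rewrite uniq_catC.
apply: eq_inj_sum => x; rewrite full_sum_upd //; last first.
  by apply: contraNN Vps => qq; apply/hasP; exists q => //=; rewrite mem_rcons inE qV orbT.
by apply: full_sum_ext => z _; rewrite joint_rename.
Qed.

Lemma merges_uniq V ps F F' : uniq (V ++ ps) ->
  all (fun r => uniq r.1.1) (merges V ps F F').
Proof.
elim: ps V F F' => [|p ps IH] V F F' /=; first by rewrite cats0 andbT.
rewrite -cat_rcons => up; rewrite all_cat IH //=.
apply/allP => r /flatten_mapP[q qV]; move: r; apply/allP; apply: IH.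
move: up; rewrite -cats1 -catA /= uniq_catC /= => /andP[_].
by rewrite uniq_catC.
Qed.

Lemma perm_extend n (A B : seq 'I_n) : uniq A -> uniq B -> size A = size B ->
  exists s : 'S_n, map s A = B.
Proof.
elim: A B => [|a A IH] [|b B] //=; first by exists 1%g.
case/andP=> aA uA /andP[bB uB] [AB].
have [s sA] := IH B uA uB AB; exists (s * tperm (s a) b)%g.
rewrite permM tpermL; congr cons; rewrite -[RHS]sA.
apply/eq_in_map => x xA /=; rewrite permM tpermD //.
- by apply: contraNneq aA => /perm_inj ->.
- by apply: contraNneq bB => ->; rewrite -sA map_f.
Qed.

(** These permutations form a coset of the pointwise stabilizer of [A], which is the symmetric group
    on the complement of [A]. *)
Lemma card_perm_prescribed n (A B : seq 'I_n) :
  uniq A -> uniq B -> size A = size B ->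
  #|[set s : 'S_n | map s A == B]| = (n - size A)`!.
Proof.
move=> uA uB AB; have [t tA] := perm_extend uA uB AB.
have -> : [set s : 'S_n | map s A == B] = [set (s * t)%g | s in perm_on [set x | x \notin A]].
  apply/setP => s; rewrite inE; apply/eqP/imsetP => [sA|[r]].
    exists (s * t^-1)%g; last by rewrite mulgKV.
    rewrite unfold_in; apply/fintype.subsetP => x; rewrite !inE; apply: contraNN => xA.
    rewrite permM -[X in _ == X](permK t); apply/eqP; congr (_ _).
    have := sA; rewrite -tA => /eq_in_map; exact.
  move=> rA ->; rewrite -tA; apply/eq_in_map => x xA.
  by rewrite permM (out_perm rA) // inE xA.
rewrite card_imset; last exact: mulIg.
rewrite card_perm; congr factorial.
have <- : #|[set x in A]| = size A by rewrite cardsE; apply/card_uniqP.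
rewrite [LHS]cardsCs card_ord; congr (_ - _); apply: eq_card => x.
by rewrite !inE negbK.
Qed.

(** Positions and images decouple: [A] holds the placed positions and [B] their images. The next
    position and its image range independently outside [A] and [B], and in the end the permutations
    compatible with both lists are counted by a factorial. *)
Lemma joint_sum n V (A B : seq 'I_n) (x y : env) g h :
  uniq A -> uniq B -> size A = size B ->
  (forall s : 'S_n, map s A = B -> perm_nat s \o x = y) ->
  \sum_(s : 'S_n | map s A == B)
     inj_sum n V (map val A) x (fun z => g z * h (perm_nat s \o z)) =
  (n - (size A + size V))`! * (inj_sum n V (map val A) x g * inj_sum n V (map val B) y h).
Proof.
elim: V A B x y => [|v V IH] A B x y uA uB AB xy /=.
  rewrite addn0 -(card_perm_prescribed uA uB AB) cardsE -sum1_card big_distrl /=.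
  by apply: eq_bigr => s /eqP /xy ->; rewrite mul1n.
rewrite exchange_big /= big_distrl big_distrr /=.
apply: eq_bigr => a aA; rewrite big_distrr big_distrr /=.
rewrite mem_map in aA; last exact: val_inj.
(* The image [b] of the new position is made a summation variable of its own, so that the sum over
   [s] can be taken last. *)
transitivity (\sum_(s : 'S_n | map s A == B) \sum_(b < n | b \notin B)
  if s a == b then inj_sum n V (nat_of_ord a :: map val A) (upd x v a)
     (fun z => g z * h (perm_nat s \o z)) else 0).
  apply: eq_bigr => s /eqP sA; rewrite (bigD1 (s a)) /=; last first.
    by rewrite -sA mem_map //; exact: perm_inj.
  by rewrite eqxx big1 ?addn0 // => b /andP[_ bs]; rewrite eq_sym (negbTE bs).
rewrite exchange_big /= [RHS](eq_bigl (fun b : 'I_n => b \notin B)); last first.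
  by move=> b; rewrite mem_map //; exact: val_inj.
apply: eq_bigr => b bB; rewrite -big_mkcondr /=.
rewrite -addSnnS -(IH (a :: A) (b :: B)) /= ?aA ?bB ?AB //.
  by apply: eq_bigl => s; rewrite eqseq_cons andbC.
move=> s [sa sA]; rewrite -(xy _ sA); apply: funext => u; rewrite /upd /=.
by case: ifP => // _; rewrite perm_nat_ord sa.
Qed.

Lemma inj_sum_joint n V F F' :
  inj_sum n V [::] (fun=> n) (joint n F F') = (n - size V)`! * (weight n V F * weight n V F').
Proof.
have := @joint_sum n V [::] [::] (fun=> n) (fun=> n) (factor_prod^~ F) (factor_prod^~ F').
rewrite /= add0n => <- //; last first.
  by move=> s _; apply: funext => u /=; rewrite /perm_nat insubN // ltnn.
rewrite /joint inj_sum_sum; apply: eq_bigl => s; by rewrite eqxx.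
Qed.

(** The jump sum [D(s)], over all pairs with the indicator of succession: in this form passing to
    [s^-1] merely exchanges the two factors. *)
Definition total_jump n (s : 'S_n) : nat :=
  \sum_(a < n) \sum_(b < n) (b == a.+1 :> nat) * ((s b - s a) + (s a - s b)).

Definition edge_stat n (t : bool) (s : 'S_n) : nat :=
  if t then total_jump s else total_jump s^-1.

(** Each entry takes two fresh vertices. [edges] of [ts] gives the factors on positions, and [edges]
    of [map negb ts] those on values: a jump of [s] is [Next] in position and [Dist] in value, a
    jump of [s^-1] the reverse. *)
Fixpoint edges i (ts : seq bool) : seq factor :=
  if ts is t :: ts' then
    (if t then Next i i.+1 else Dist i.+1 i) :: edges i.+2 ts' else [::].

Lemma edge_statE n t (s : 'S_n) (e : env) i :
  edge_stat t s = \sum_(a < n) \sum_(b < n)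
    factor_val (upd (upd e i a) i.+1 b) (if t then Next i i.+1 else Dist i.+1 i) *
    factor_val (perm_nat s \o upd (upd e i a) i.+1 b) (if ~~ t then Next i i.+1 else Dist i.+1 i).
Proof.
have ii : i == i.+1 = false by lia.
case: t => /=.
  by apply: eq_bigr => a _; apply: eq_bigr => b _; rewrite /upd !eqxx ii !perm_nat_ord.
rewrite /total_jump (reindex_inj (@perm_inj _ s)); apply: eq_bigr => a _ /=.
rewrite (reindex_inj (@perm_inj _ s)); apply: eq_bigr => b _ /=.
by rewrite /upd !eqxx ii !perm_nat_ord !permK mulnC.
Qed.

Lemma prod_edge_stat n ts (s : 'S_n) (e : env) i :
  \prod_(t <- ts) edge_stat t s =
  full_sum n (iota i (size ts).*2) e
    (fun x => factor_prod x (edges i ts) * factor_prod (perm_nat s \o x) (edges i (map negb ts))).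
Proof.
elim: ts i e => [|t ts IH] i e /=; first by rewrite big_nil /factor_prod !big_nil.
rewrite big_cons (edge_statE t s e i) big_distrl; apply: eq_bigr => a _ /=.
rewrite big_distrl; apply: eq_bigr => b _ /=.
rewrite (IH i.+2 (upd (upd e i a) i.+1 b)) -full_sum_scale; apply: full_sum_ext => x xe.
have Ei : x i = upd (upd e i a) i.+1 b i by rewrite xe // mem_iota; lia.
have Ej : x i.+1 = upd (upd e i a) i.+1 b i.+1 by rewrite xe // mem_iota; lia.
rewrite !factor_prod_cons mulnACA; congr (_ * _).
  by case: t => /=; rewrite -Ei -Ej.
by case: t => /=; rewrite -Ei -Ej.
Qed.

Theorem moment_merges n ts :
  \sum_(s : 'S_n) \prod_(t <- ts) edge_stat t s =
  \sum_(r <- merges [::] (iota 0 (size ts).*2) (edges 0 ts) (edges 0 (map negb ts)))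
     (n - size r.1.1)`! * (weight n r.1.1 r.1.2 * weight n r.1.1 r.2).
Proof.
transitivity (inj_sum n [::] [::] (fun=> n) (fun x =>
   full_sum n (iota 0 (size ts).*2) x (joint n (edges 0 ts) (edges 0 (map negb ts))))).
  rewrite /= /joint full_sum_sum; apply: eq_bigr => s _; exact: prod_edge_stat.
rewrite mergesP ?iota_uniq //; apply: eq_bigr => r _; exact: inj_sum_joint.
Qed.

Import Order.TTheory GRing.Theory Num.Theory.
Import numFieldNormedType.Exports.
Local Open Scope ring_scope.

(** * Polynomial identities checked by computation *)

Definition zpoly := seq Z.

Fixpoint padd (p q : zpoly) : zpoly :=
  match p, q with
  | [::], _ => q
  | _, [::] => p
  | a :: p', b :: q' => Z.add a b :: padd p' q'
  end.
Definition pscale (a : Z) (p : zpoly) : zpoly := [seq Z.mul a b | b <- p].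
Fixpoint pmul (p q : zpoly) : zpoly :=
  if p is a :: p' then padd (pscale a q) (Z0 :: pmul p' q) else [::].

Section eval.
Context {R : numDomainType}.
Definition zr (z : Z) : R := (int_of_Z z)%:~R.
Fixpoint peval (p : zpoly) (x : R) : R :=
  if p is a :: p' then zr a + x * peval p' x else 0.

Lemma zrD a b : zr (Z.add a b) = zr a + zr b.
Proof. by rewrite /zr -rmorphD /= -rmorphD. Qed.
Lemma zrM a b : zr (Z.mul a b) = zr a * zr b.
Proof. by rewrite /zr -rmorphM /= -rmorphM. Qed.
Lemma zr0 : zr Z0 = 0. Proof. by []. Qed.
Lemma zr_nat n : zr (Z.of_nat n) = n%:R.
Proof. by rewrite /zr; have -> : int_of_Z (Z.of_nat n) = n%:Z by lia. Qed.
Lemma zr_N n : zr (Z.of_N n) = (nat_of_bin n)%:R.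
Proof. by rewrite /zr; have -> : int_of_Z (Z.of_N n) = (nat_of_bin n)%:Z by lia. Qed.
Lemma zrN a : zr (Z.opp a) = - zr a.
Proof. by rewrite /zr -rmorphN; congr (_%:~R); lia. Qed.

Lemma pevalD p q x : peval (padd p q) x = peval p x + peval q x.
Proof.
elim: p q => [|a p IH] [|b q] /=; rewrite ?add0r ?addr0 //.
by rewrite zrD IH; ring.
Qed.
Lemma pevalZ a p x : peval (pscale a p) x = zr a * peval p x.
Proof. by elim: p => [|b p IH] /=; rewrite ?mulr0 // zrM IH; ring. Qed.
Lemma pevalM p q x : peval (pmul p q) x = peval p x * peval q x.
Proof.
elim: p => [|a p IH] /=; rewrite ?mul0r // pevalD pevalZ /= IH zr0; ring.
Qed.
End eval.
Arguments padd : simpl never.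
Arguments pmul : simpl never.

(** Reified polynomials: one term is normalized to integer coefficients for computation and
    evaluated in the field for the closed formulas. *)
Inductive pexpr := PX | PC of nat | PAdd of pexpr & pexpr | PSub of pexpr & pexpr
  | PMul of pexpr & pexpr | PExp of pexpr & nat.

Fixpoint pnorm (e : pexpr) : zpoly :=
  match e with
  | PX => [:: Z0; Zpos xH]
  | PC n => [:: Z.of_nat n]
  | PAdd a b => padd (pnorm a) (pnorm b)
  | PSub a b => padd (pnorm a) (pscale (Zneg xH) (pnorm b))
  | PMul a b => pmul (pnorm a) (pnorm b)
  | PExp a n => iter n (pmul (pnorm a)) [:: Zpos xH]
  end.

Fixpoint pexpr_eval {R : numDomainType} (e : pexpr) (x : R) : R :=
  match e with
  | PX => x
  | PC n => n%:R
  | PAdd a b => pexpr_eval a x + pexpr_eval b x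
  | PSub a b => pexpr_eval a x - pexpr_eval b x
  | PMul a b => pexpr_eval a x * pexpr_eval b x
  | PExp a n => pexpr_eval a x ^+ n
  end.

Lemma pnormP (R : numDomainType) e (x : R) : peval (pnorm e) x = pexpr_eval e x.
Proof.
have z1 : zr (Zpos xH) = 1 :> R by [].
elim: e => [|n|a IHa b IHb|a IHa b IHb|a IHa b IHb|a IHa n] /=.
- rewrite zr0 z1; ring.
- by rewrite zr_nat mulr0 addr0.
- by rewrite pevalD IHa IHb.
- rewrite pevalD pevalZ IHa IHb (_ : zr (Zneg xH) = -1) //; ring.
- by rewrite pevalM IHa IHb.
- by elim: n => [|n IHn] /=; rewrite ?mulr0 ?addr0 // pevalM IHn IHa exprS.
Qed.

Definition fact_ratio L j : Z :=
  foldr (fun i r => Z.mul (Z.of_nat i) r) (Zpos xH) (iota j.+1 (L - j)).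

Lemma fact_ratioP (R : numDomainType) L j : (j <= L)%N ->
  zr (fact_ratio L j) * j`!%:R = L`!%:R :> R.
Proof.
rewrite /fact_ratio; move E : (L - j)%N => d; elim: d j E => [|d IH] j E jL.
  have -> : j = L by lia.
  by rewrite /= mul1r.
have e1 : (L - j.+1 = d)%N by lia.
have e2 : (j.+1 <= L)%N by lia.
rewrite -(IH _ e1 e2).
rewrite -[foldr _ _ (iota j.+1 d.+1)]/(Z.mul (Z.of_nat j.+1)
  (foldr (fun i r => Z.mul (Z.of_nat i) r) (Zpos xH) (iota j.+2 d))).
by rewrite zrM zr_nat factS natrM; ring.
Qed.

Definition linear_poly (c : nat) : zpoly := [:: Z.opp (Z.of_nat c); Zpos xH].

Lemma linear_polyE (R : numDomainType) c (x : R) : peval (linear_poly c) x = x - c%:R.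
Proof. rewrite /linear_poly /= zrN zr_nat (_ : zr (Zpos xH) = 1) //; ring. Qed.

(* Horner scheme in the factors [n - (g + j)]; scaling by [L!] keeps the coefficients
   integral. *)
Fixpoint newton_poly L j g (a : seq N) : zpoly :=
  if a is c :: a' then
    padd [:: Z.mul (Z.of_N c) (fact_ratio L j)]
         (pmul (linear_poly (g + j)) (newton_poly L j.+1 g a'))
  else [::].

(** The falling factorial of [n - g] carried along the Horner scheme turns [j!] times a binomial
    into a product of linear factors; [fact_ratio L j] supplies the missing [L!/j!]. *)
Lemma newton_polyP (R : numDomainType) L j g a n : (size a + j <= L.+1)%N -> (g <= n)%N ->
  peval (newton_poly L j g a) n%:R * ((n - g) ^_ j)%:R =
  L`!%:R * (\sum_(i < size a) nth 0%N (map nat_of_bin a) i * 'C(n - g, j + i))%:R :> R.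
Proof.
move=> + gn; elim: a j => [|c a IH] j /= aL.
  by rewrite big_ord0 mul0r mulr0.
rewrite big_ord_recl /= addn0 pevalD pevalM linear_polyE [peval [:: _] _]/= mulr0 addr0 zrM zr_N.
rewrite [X in _ = _ * X]natrD mulrDr mulrDl; congr (_ + _).
  rewrite -(@fact_ratioP _ L j); last by lia.
  by rewrite -bin_ffact !natrM; ring.
have := IH j.+1; rewrite addnS ffactnSr => /(_ aL).
have -> : (\sum_(i < size a) nth 0%N [seq nat_of_bin i | i <- a] i * 'C(n - g, j.+1 + i) =
     \sum_(i < size a) nth 0%N [seq nat_of_bin i | i <- c :: a] (bump 0 i) * 'C(n - g, j + bump 0 i))%N.
  by apply: eq_bigr => i _; rewrite /bump /= add1n addnS.
(* For [j > n - g] the truncated subtraction differs from the linear factor, but the falling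
   factorial is then zero on both sides. *)
move=> <-; case: (leqP j (n - g)) => jn.
  rewrite natrM natrB // natrD natrB //; ring.
by rewrite ffact_small // mul0n !mulr0.
Qed.

(** An identically zero weight is returned as the empty polynomial, which lets [add_row] skip the
    other weight of the row. *)
Definition row_poly L V F : option (nat * zpoly) :=
  if compile V F is Some (g, a) then
    if (size a <= L.+1)%N then
    Some (g, if all (fun c => N.eqb c N0) a then [::] else newton_poly L 0 g a) else None
  else None.

Lemma row_polyP (R : numDomainType) L V F g p n : uniq V -> row_poly L V F = Some (g, p) ->
  (g <= n)%N -> peval p n%:R = L`!%:R * (weight n V F)%:R :> R.
Proof.
rewrite /row_poly => uV; case E : (compile V F) => [[g' a]|] //.
case: ifPn => // aL [<- <-] gn; rewrite (compileP uV E gn) /newton size_map.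
case: ifPn => [/all_nthP a0|_].
  rewrite big1 ?mulr0 // => j _; rewrite (nth_map N0) //.
  by have /N.eqb_eq -> := a0 N0 j (ltn_ord j).
have := @newton_polyP R L 0 g' a n; rewrite addn0 ffactn0 mulr1 => -> //.
Qed.

Fixpoint add_nth k (p : zpoly) (t : seq zpoly) : seq zpoly :=
  match k, t with
  | 0, [::] => [:: p]
  | 0, q :: t' => padd p q :: t'
  | k'.+1, [::] => [::] :: add_nth k' p [::]
  | k'.+1, q :: t' => q :: add_nth k' p t'
  end.

(** Rows are collected by the number of blocks, which fixes their factorial [(n - size V)!]. The
    test [g <= 4] makes the polynomials valid for every [n >= 4]. *)
Definition add_row L (r : seq nat * seq factor * seq factor)
    (acc : option (seq zpoly)) : option (seq zpoly) :=
  let: (V, F, F') := r in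
  if acc is Some t then
    if has degenerate F || has degenerate F' then acc else
    if row_poly L V F is Some (g, p) then
      if p is [::] then if (g <= 4)%N then Some t else None else
      if row_poly L V F' is Some (g', p') then
        if (g <= 4)%N && (g' <= 4)%N then Some (add_nth (size V) (pmul p p') t) else None
      else None
    else None
  else None.

Definition moment_rows ts :=
  merges [::] (iota 0 (size ts).*2) (edges 0 ts) (edges 0 (map negb ts)).

Definition table L ts := foldr (add_row L) (Some [::]) (moment_rows ts).

Fixpoint tval {R : numDomainType} k (t : seq zpoly) n : R :=
  if t is p :: t' then (n - k)`!%:R * peval p n%:R + tval k.+1 t' n else 0.

Lemma tval_add_nth (R : numDomainType) j k p t n :
  tval j (add_nth k p t) n = (n - (j + k))`!%:R * peval p n%:R + tval j t n :> R.
Proof.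
elim: k j t => [|k IH] j [|q t] /=; rewrite ?addn0 ?pevalD ?mulrDr ?addrA //.
  by rewrite IH mulr0 add0r addSnnS.
by rewrite IH addrCA addrA addSnnS.
Qed.

Lemma tableP (R : numDomainType) L ts t n : (4 <= n)%N -> table L ts = Some t ->
  L`!%:R ^+ 2 * (\sum_(s : 'S_n) \prod_(b <- ts) edge_stat b s)%N%:R = tval 0 t n :> R.
Proof.
move=> n4; rewrite moment_merges /table -/(moment_rows ts).
have /allP : all (fun r : seq nat * seq factor * seq factor => uniq r.1.1) (moment_rows ts).
  by apply: merges_uniq; rewrite iota_uniq.
elim: (moment_rows ts) t => [|[[V F] F'] r IH] t ur /=; first by move=> [<-]; rewrite big_nil mulr0.
have uV : uniq V by exact: (ur (V, F, F') (mem_head _ _)).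
have {}ur : {in r, forall x, uniq x.1.1} by move=> x xr; apply: ur; rewrite inE xr orbT.
case Er : (foldr _ _ _) => [t'|] //.
rewrite big_cons natrD mulrDr (IH t') //= natrM natrM.
case: ifP => [/orP dF [<-]|_].
  by case: dF => dF; rewrite (weight_degenerate n V dF) ?mulr0 ?mul0r ?mulr0 add0r.
case E : (row_poly L V F) => [[g p]|] //.
case: p E => [|c p] E.
  case: ifP => // g4 [<-].
  have : L`!%:R * (weight n V F)%:R = 0 :> R.
    by rewrite -(row_polyP R uV E) // (leq_trans g4).
  move=> /eqP; rewrite mulf_eq0 pnatr_eq0 eqn0Ngt fact_gt0 orFb.
  by move=> /eqP ->; rewrite mul0r !mulr0 add0r.
case E' : (row_poly L V F') => [[g' p']|] //.
case: ifP => // /andP[g4 g4'] [<-].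
rewrite tval_add_nth pevalM (row_polyP R uV E) ?(row_polyP R uV E') //; first 1 last.
- exact: leq_trans g4' _.
- exact: leq_trans g4 _.
by rewrite add0n; congr (_ + _); ring.
Qed.

(* Horner scheme for [\sum_k (n - k)! t_k(n) / (n - K)!], where [K = size t]. *)
Fixpoint combine j (H : zpoly) (t : seq zpoly) : zpoly :=
  if t is p :: t' then combine j.+1 (pmul (linear_poly j) (padd H p)) t' else H.

Lemma combineP (R : numDomainType) j H t n : (j + size t <= n)%N ->
  (n - (j + size t))`!%:R * peval (combine j H t) n%:R =
  (n - j)`!%:R * peval H n%:R + tval j t n :> R.
Proof.
elim: t j H => [|p t IH] j H /= jn; first by rewrite !addn0 addr0.
rewrite addnS -addSn IH; last by rewrite addSn -addnS.
rewrite pevalM linear_polyE pevalD.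
have -> : (n - j = (n - j.+1).+1)%N by lia.
rewrite factS natrM (_ : (n - j.+1).+1 = (n - j)%N); last by lia.
rewrite natrB; last by lia.
ring.
Qed.

Fixpoint zeval (p : zpoly) (x : Z) : Z :=
  if p is a :: p' then Z.add a (Z.mul x (zeval p' x)) else Z0.

Lemma zevalP (R : numDomainType) p n : zr (zeval p (Z.of_nat n)) = peval p n%:R :> R.
Proof. by elim: p => //= a p IH; rewrite zrD zrM IH zr_nat. Qed.

Definition zfact n := fact_ratio n 0.
Lemma zfactP (R : numDomainType) n : zr (zfact n) = n`!%:R :> R.
Proof. by rewrite -(@fact_ratioP R n 0) // mulr1. Qed.

Fixpoint ztval k (t : seq zpoly) n : Z :=
  if t is p :: t' then
    Z.add (Z.mul (zfact (n - k)) (zeval p (Z.of_nat n))) (ztval k.+1 t' n)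
  else Z0.

Lemma ztvalP (R : numDomainType) k t n : zr (ztval k t n) = tval k t n :> R.
Proof. by elim: t k => //= p t IH k; rewrite zrD zrM zfactP zevalP IH. Qed.

(** Below [size t] the factorials [(n - k)!] are truncated and have no common polynomial form, so
    these finitely many values are checked numerically. *)
Definition check_small L (t : seq zpoly) (num den : zpoly) n : bool :=
  Z.eqb (Z.mul (zeval den (Z.of_nat n)) (ztval 0 t n))
     (Z.mul (Z.mul (zfact L) (zfact L)) (Z.mul (zeval num (Z.of_nat n)) (zfact n))).

(** After division by [(n - size t)!] both sides are polynomials in [n]; the second [combine],
    started at 1 with empty rows, is the falling factorial [n! / (n - size t)!]. *)
Definition check_large L (t : seq zpoly) (num den : zpoly) : bool :=
  all (Z.eqb Z0) (padd (pmul den (combine 0 [::] t))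
    (pscale (Z.opp (Z.mul (zfact L) (zfact L)))
      (pmul num (combine 0 [:: Zpos xH] (nseq (size t) [::]))))).

Definition check_table L ts num den : bool :=
  if table L ts is Some t then
    all (check_small L t num den) (iota 4 (size t - 4)) && check_large L t num den
  else false.

Theorem momentP (R : numDomainType) L ts (num den : pexpr) n :
  check_table L ts (pnorm num) (pnorm den) -> (4 <= n)%N ->
  pexpr_eval den n%:R * (\sum_(s : 'S_n) \prod_(b <- ts) edge_stat b s)%N%:R =
  pexpr_eval num n%:R * n`!%:R :> R.
Proof.
rewrite /check_table; case E : (table _ _) => [t|] // /andP[small large] n4.
have L0 : L`!%:R ^+ 2 != 0 :> R by rewrite sqrf_eq0 pnatr_eq0 -lt0n fact_gt0.
apply: (mulfI L0); rewrite mulrCA (tableP R n4 E) -!pnormP.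
case: (ltnP n (size t)) => nt.
  have nt' : n \in iota 4 (size t - 4) by rewrite mem_iota; lia.
  have /(proj1 (Z.eqb_eq _ _)) := allP small n nt'; move=> /(congr1 (@zr R)).
  rewrite !zrM !zfactP !zevalP ztvalP => ->.
  by rewrite expr2.
have K0 : (n - size t)`!%:R != 0 :> R by rewrite pnatr_eq0 -lt0n fact_gt0.
have e1 := @combineP R 0 [::] t n; rewrite /= add0n mulr0 add0r in e1.
rewrite -(e1 nt) {e1}.
have tval0 j k : tval j (nseq k [::]) n = 0 :> R.
  by elim: k j => //= k IHk j; rewrite mulr0 add0r IHk.
have e2 := @combineP R 0 [:: Zpos xH] (nseq (size t) [::]) n.
rewrite /= size_nseq add0n mulr0 addr0 subn0 tval0 addr0 in e2.
have {}e2 : n`!%:R = (n - size t)`!%:R *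
    peval (combine 0 [:: Zpos xH] (nseq (size t) [::])) n%:R :> R.
  by rewrite (e2 nt) (_ : zr (Zpos xH) = 1) ?mulr1.
rewrite {}e2.
have all0P p : all (Z.eqb Z0) p -> peval p n%:R = 0 :> R.
  elim: p => [//|a p IHp /andP[a0 p0]].
  by rewrite [LHS]/= (IHp p0) -(proj1 (Z.eqb_eq _ _) a0) zr0 mulr0 addr0.
move/all0P: large; rewrite pevalD pevalZ !pevalM zrN zrM !zfactP => e3.
have {e3} : peval (pnorm den) n%:R * peval (combine 0 [::] t) n%:R =
    L`!%:R * L`!%:R * (peval (pnorm num) n%:R *
      peval (combine 0 [:: Zpos xH] (nseq (size t) [::])) n%:R) :> R.
  by apply/eqP; rewrite -subr_eq0 -mulNr e3.
move=> e4; rewrite mulrCA e4 expr2; ring.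
Qed.

(* Covers [n < 4], where the shifts [g <= 4] make the polynomial form unavailable. *)
Definition check_direct n ts num den : bool :=
  Z.eqb (Z.mul (zeval den (Z.of_nat n)) (Z.of_nat
    (sumn [seq (n - size r.1.1)`! * (weight_eval n r.1.1 r.1.2 * weight_eval n r.1.1 r.2)
      | r <- moment_rows ts]%N)))
    (Z.mul (zeval num (Z.of_nat n)) (zfact n)).

Theorem moment_small (R : numDomainType) ts (num den : pexpr) n :
  check_direct n ts (pnorm num) (pnorm den) ->
  pexpr_eval den n%:R * (\sum_(s : 'S_n) \prod_(b <- ts) edge_stat b s)%N%:R =
  pexpr_eval num n%:R * n`!%:R :> R.
Proof.
rewrite /check_direct moment_merges => /(proj1 (Z.eqb_eq _ _)) /(congr1 (@zr R)).
rewrite !zrM zr_nat !zevalP !pnormP zfactP => <-; congr (_ * _%:R).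
rewrite sumnE big_map big_seq [RHS]big_seq; apply: eq_bigr => r rr.
have ur : uniq r.1.1.
  by move: r rr; apply/allP; apply: merges_uniq; rewrite iota_uniq.
by rewrite !weight_evalP.
Qed.

(** * Closed forms of the moments and their verification *)

Fixpoint horner_expr (c : seq pexpr) : pexpr :=
  if c is a :: c' then PAdd a (PMul PX (horner_expr c')) else PC 0.
Definition pos_coef a b := PAdd (PMul (PC a) (PC 1000)) (PC b).
Definition neg_coef a b := PSub (PC 0) (pos_coef a b).

(** With one digit the quotient is the mean of that power of [D], with two digits [ab] the mean of
    [D(s)^a D(s^-1)^b]. Coefficients start from the constant term. *)
Definition num1 := horner_expr [:: neg_coef 0 1; PC 0; PC 1].
Definition den1 := PC 3.
Definition num2 := horner_expr [:: PC 24; neg_coef 0 1; neg_coef 0 31; PC 4; PC 10].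
Definition den2 := PC 90.
Definition num3 := horner_expr [:: neg_coef 0 612; neg_coef 0 225; PC 784; neg_coef 0 66;
  neg_coef 0 449; PC 84; PC 70].
Definition den3 := pos_coef 1 890.
Definition num4 := horner_expr [:: pos_coef 18 0; pos_coef 12 447; neg_coef 20 318;
  neg_coef 3 930; pos_coef 12 825; neg_coef 2 202; neg_coef 3 702; PC 840; PC 350].
Definition den4 := pos_coef 28 350.
Definition num11 := horner_expr [:: neg_coef 0 6; PC 14; neg_coef 0 9; PC 0; PC 0; PC 1].
Definition den11 := PMul (PC 9) PX.
Definition num21 := horner_expr [:: PC 540; PC 54; neg_coef 0 621; PC 543; neg_coef 0 217;
  neg_coef 0 1; PC 4; PC 10].
Definition den21 := PMul (PC 270) PX.
Definition num22 := horner_expr [:: pos_coef 195 480; neg_coef 79 416; pos_coef 33 846;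
  neg_coef 104 141; pos_coef 99 349; neg_coef 55 879; pos_coef 22 469; neg_coef 5 344;
  PC 116; neg_coef 0 20; PC 100].
Definition den22 := PMul (pos_coef 8 100) (PMul PX (PSub PX (PC 1))).

(* 12 bounds the number of non-idle steps: at most 8 placements, and one further step
   for each of at most 4 [Dist] factors. *)
Lemma table_ok1 : check_table 12 [:: true] (pnorm num1) (pnorm den1).
Proof. by vm_cast_no_check (erefl true). Qed.
Lemma table_ok2 : check_table 12 [:: true; true] (pnorm num2) (pnorm den2).
Proof. by vm_cast_no_check (erefl true). Qed.
Lemma table_ok3 : check_table 12 [:: true; true; true] (pnorm num3) (pnorm den3).
Proof. by vm_cast_no_check (erefl true). Qed.
Lemma table_ok4 : check_table 12 [:: true; true; true; true] (pnorm num4) (pnorm den4).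
Proof. by vm_cast_no_check (erefl true). Qed.
Lemma table_ok11 : check_table 12 [:: true; false] (pnorm num11) (pnorm den11).
Proof. by vm_cast_no_check (erefl true). Qed.
Lemma table_ok21 : check_table 12 [:: true; true; false] (pnorm num21) (pnorm den21).
Proof. by vm_cast_no_check (erefl true). Qed.
Lemma table_ok22 : check_table 12 [:: true; true; false; false] (pnorm num22) (pnorm den22).
Proof. by vm_cast_no_check (erefl true). Qed.
Lemma direct_ok1 :
  all (fun n => check_direct n [:: true] (pnorm num1) (pnorm den1)) [:: 2; 3]%N.
Proof. by vm_cast_no_check (erefl true). Qed.
Lemma direct_ok2 :
  all (fun n => check_direct n [:: true; true] (pnorm num2) (pnorm den2)) [:: 2; 3]%N.
Proof. by vm_cast_no_check (erefl true). Qed.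
Lemma direct_ok11 :
  all (fun n => check_direct n [:: true; false] (pnorm num11) (pnorm den11)) [:: 2; 3]%N.
Proof. by vm_cast_no_check (erefl true). Qed.
Lemma direct_ok21 :
  all (fun n => check_direct n [:: true; true; false] (pnorm num21) (pnorm den21)) [:: 2; 3]%N.
Proof. by vm_cast_no_check (erefl true). Qed.
Lemma direct_ok22 :
  all (fun n => check_direct n [:: true; true; false; false] (pnorm num22) (pnorm den22)) [:: 2; 3]%N.
Proof. by vm_cast_no_check (erefl true). Qed.

(** * Means of the jump sum over the symmetric group *)

Section means.
Context {R : numFieldType} {n : nat}.
Implicit Type f g : 'S_n -> R.

Definition perm_mean f : R := (\sum_(s : 'S_n) f s) / n`!%:R.
Definition jump (s : 'S_n) : R := (total_jump s)%:R.

Lemma perm_mean_moment f ts num den : pexpr_eval den n%:R != 0 :> R ->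
  (check_table 12 ts (pnorm num) (pnorm den) && (4 <= n)%N) ||
     check_direct n ts (pnorm num) (pnorm den) ->
  (forall s, f s = \prod_(b <- ts) if b then jump s else jump s^-1%g) ->
  perm_mean f = pexpr_eval num n%:R / pexpr_eval den n%:R.
Proof.
move=> d0 ok fE; have n0 : n`!%:R != 0 :> R by rewrite pnatr_eq0 -lt0n fact_gt0.
have E : pexpr_eval den n%:R * (\sum_(s : 'S_n) \prod_(b <- ts) edge_stat b s)%N%:R =
  pexpr_eval num n%:R * n`!%:R :> R.
  by case/orP: ok => [/andP[ok n4]|ok]; [exact: momentP ok n4 | exact: moment_small].
apply: (canRL (mulfK d0)); rewrite /perm_mean mulrAC; apply: (canLR (mulfK n0)).
rewrite -E mulrC; congr (_ * _); rewrite natr_sum; apply: eq_bigr => s _.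
by rewrite fE natr_prod; apply: eq_bigr => -[].
Qed.

Hypothesis n_ge2 : (2 <= n)%N.

Let direct_or ts num den : check_table 12 ts (pnorm num) (pnorm den) ->
  all (fun n => check_direct n ts (pnorm num) (pnorm den)) [:: 2; 3]%N ->
  (check_table 12 ts (pnorm num) (pnorm den) && (4 <= n)%N) ||
     check_direct n ts (pnorm num) (pnorm den).
Proof.
move=> ->; case: (leqP 4 n) => [//|n4] /allP d; apply/orP; right; apply: d.
by rewrite !inE; lia.
Qed.

Let N : R := n%:R.
Let N0 : N != 0. Proof. by rewrite pnatr_eq0; lia. Qed.
Let N1 : N - 1 != 0.
Proof. by rewrite subr_eq0 (_ : 1 = 1%N%:R) // eqr_nat; lia. Qed.

Lemma mean_jump : perm_mean jump =
  (N ^+ 2 - 1) / 3.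
Proof.
have d0 : pexpr_eval den1 n%:R != 0 :> R by rewrite /= pnatr_eq0.
rewrite (perm_mean_moment d0 (direct_or table_ok1 direct_ok1)) => [|s].
  by congr (_ / _); rewrite /=; ring.
by rewrite !big_cons big_nil; ring.
Qed.

Lemma mean_jump2 : perm_mean (fun s => jump s ^+ 2) =
  (10 * N ^+ 4 + 4 * N ^+ 3 - 31 * N ^+ 2 - N + 24) / 90.
Proof.
have d0 : pexpr_eval den2 n%:R != 0 :> R by rewrite /= pnatr_eq0.
rewrite (perm_mean_moment d0 (direct_or table_ok2 direct_ok2)) => [|s].
  by congr (_ / _); rewrite /=; ring.
by rewrite !big_cons big_nil; ring.
Qed.

Lemma mean_jump11 : perm_mean (fun s => jump s * jump s^-1) =
  (N ^+ 5 - 9 * N ^+ 2 + 14 * N - 6) / (9 * N).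
Proof.
have d0 : pexpr_eval den11 n%:R != 0 :> R by rewrite /= mulf_neq0 // pnatr_eq0.
rewrite (perm_mean_moment d0 (direct_or table_ok11 direct_ok11)) => [|s].
  by congr (_ / _); rewrite /=; ring.
by rewrite !big_cons big_nil; ring.
Qed.

Lemma mean_jump21 : perm_mean (fun s => jump s ^+ 2 * jump s^-1) =
  (10 * N ^+ 7 + 4 * N ^+ 6 - N ^+ 5 - 217 * N ^+ 4 + 543 * N ^+ 3 - 621 * N ^+ 2 + 54 * N
    + 540) / (270 * N).
Proof.
have d0 : pexpr_eval den21 n%:R != 0 :> R by rewrite /= mulf_neq0 // pnatr_eq0.
rewrite (perm_mean_moment d0 (direct_or table_ok21 direct_ok21)) => [|s].
  by congr (_ / _); rewrite /=; ring.
by rewrite !big_cons big_nil; ring.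
Qed.

Lemma mean_jump22 : perm_mean (fun s => jump s ^+ 2 * jump s^-1 ^+ 2) =
  (100 * N ^+ 10 - 20 * N ^+ 9 + 116 * N ^+ 8 - (5 * 1000 + 344) * N ^+ 7 + (22 * 1000
    + 469) * N ^+ 6 - (55 * 1000 + 879) * N ^+ 5 + (99 * 1000 + 349) * N ^+ 4 - (104 * 1000
    + 141) * N ^+ 3 + (33 * 1000 + 846) * N ^+ 2 - (79 * 1000 + 416) * N + (195 * 1000
    + 480)) / ((8 * 1000 + 100) * (N * (N - 1))).
Proof.
have c0 : 8%:R * 1000%:R + 100%:R != 0 :> R.
  by rewrite -natrM -natrD pnatr_eq0 addn_eq0 andbF.
have d0 : pexpr_eval den22 n%:R != 0 :> R := mulf_neq0 c0 (mulf_neq0 N0 N1).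
rewrite (perm_mean_moment d0 (direct_or table_ok22 direct_ok22)) => [|s].
  by congr (_ / _); rewrite /=; ring.
by rewrite !big_cons big_nil; ring.
Qed.

Lemma mean_jump3 : (4 <= n)%N -> perm_mean (fun s => jump s ^+ 3) =
  (70 * N ^+ 6 + 84 * N ^+ 5 - 449 * N ^+ 4 - 66 * N ^+ 3 + 784 * N ^+ 2 - 225 * N - 612)
    / (1 * 1000 + 890).
Proof.
move=> n4; have d0 : pexpr_eval den3 n%:R != 0 :> R.
  by rewrite /= -natrM -natrD pnatr_eq0 addn_eq0 andbF.
rewrite (perm_mean_moment d0 (introT orP (or_introl (introT andP (conj table_ok3 n4))))) => [|s].
  by congr (_ / _); rewrite /=; ring.
by rewrite !big_cons big_nil; ring.
Qed.

(** The bound on [n] matters: for [n = 2] the jump sum is always 1, while the closed form gives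
    25110/28350. *)
Lemma mean_jump4 : (4 <= n)%N -> perm_mean (fun s => jump s ^+ 4) =
  (350 * N ^+ 8 + 840 * N ^+ 7 - (3 * 1000 + 702) * N ^+ 6 - (2 * 1000 + 202) * N ^+ 5
    + (12 * 1000 + 825) * N ^+ 4 - (3 * 1000 + 930) * N ^+ 3 - (20 * 1000 + 318) * N ^+ 2
    + (12 * 1000 + 447) * N + (18 * 1000)) / (28 * 1000 + 350).
Proof.
move=> n4; have d0 : pexpr_eval den4 n%:R != 0 :> R.
  by rewrite /= -natrM -natrD pnatr_eq0 addn_eq0 andbF.
rewrite (perm_mean_moment d0 (introT orP (or_introl (introT andP (conj table_ok4 n4))))) => [|s].
  by congr (_ / _); rewrite /=; ring.
by rewrite !big_cons big_nil; ring.
Qed.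

Lemma perm_meanV f : perm_mean (fun s => f s^-1%g) = perm_mean f.
Proof. by rewrite /perm_mean (reindex_inj invg_inj); under eq_bigr do rewrite invgK. Qed.
End means.

Local Open Scope classical_set_scope.
Local Open Scope ring_scope.

(** * Uniform distribution of the rank permutations *)

Lemma measurable_forall d (T : measurableType d) (I : finType) (B : I -> set T) :
  (forall i, measurable (B i)) -> measurable [set x | forall i, B i x].
Proof.
move=> mB; rewrite (_ : [set x | _] = \bigcap_(i in [set: I]) B i).
  by apply: fin_bigcap_measurable => //; exact: finite_finset.
by apply/seteqP; split => x /= Bx i //; exact: Bx.
Qed.

Section tuple_law.
Context {d' : measure_display} {U : measurableType d'} {m : nat}.

Definition box (B : 'I_m -> set U) : set (m.-tuple U) :=
  [set t | forall j, B j (tnth t j)].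

Lemma measurable_box (B : 'I_m -> set U) :
  (forall j, measurable (B j)) -> measurable (box B).
Proof.
move=> mB; apply: measurable_forall => j; rewrite -[X in measurable X]setTI.
exact: (measurable_tnth j measurableT (mB j)).
Qed.

Definition boxes : set (set (m.-tuple U)) :=
  [set A | exists2 B : 'I_m -> set U, (forall j, measurable (B j)) & A = box B].

Lemma boxes_setI : setI_closed boxes.
Proof.
move=> _ _ [A mA ->] [B mB ->]; exists (fun j => A j `&` B j).
  by move=> j; exact: measurableI.
apply/seteqP; split => [t [At Bt] j|t AB]; first by split; [exact: At|exact: Bt].
by split => j; have [] := AB j.
Qed.

Lemma measurable_boxes : measurable = <<s boxes >>.
Proof.
apply/seteqP; split; last first.
  apply: smallest_sub; first exact: sigma_algebra_measurable.
  by move=> _ [B mB ->]; exact: measurable_box.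
apply: smallest_sub; first exact: smallest_sigma_algebra.
rewrite -bigcup_seq => A [i _ [B mB <-]].
apply: sub_sigma_algebra.
exists (fun j => if j == i then B else setT); first by move=> j; case: ifP.
apply/seteqP; split => t /=.
  by move=> [_ Bt] j; case: eqP => // ->.
by move=> /(_ i); rewrite eqxx.
Qed.

Lemma tuple_law_unique (R : realType) (m1 m2 : {measure set (m.-tuple U) -> \bar R}) :
  (m1 setT < +oo)%E ->
  (forall B : 'I_m -> set U, (forall j, measurable (B j)) -> m1 (box B) = m2 (box B)) ->
  forall A, measurable A -> m1 A = m2 A.
Proof.
move=> m1oo m12; apply: (measure_unique boxes (fun=> setT)) => //.
- exact: measurable_boxes.
- exact: boxes_setI.
- by move=> _; exists (fun=> setT) => //; apply/seteqP; split.
- by rewrite bigcup_const //; exists 0%N.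
- by move=> _ [B mB ->]; exact: m12.
Qed.
End tuple_law.

Section array_law.
Context d (T : measurableType d) (R : realType) (P : probability T R) (I : finType).
Implicit Type X Y : I -> {RV P >-> R}.

Definition array X (w : T) : #|I|.-tuple R := [tuple X (enum_val j) w | j < #|I|].

Lemma measurable_array X : measurable_fun setT (array X).
Proof.
apply/measurable_fun_tnthP => j; rewrite (_ : _ \o _ = X (enum_val j)) //.
by apply/funext => w /=; rewrite tnth_mktuple.
Qed.

(* Boxes form a pi-system that generates the product sigma-algebra. *)
Lemma array_law X Y :
  (forall B : I -> set R, (forall i, measurable (B i)) ->
    P [set w | forall i, B i (X i w)] = P [set w | forall i, B i (Y i w)]) ->
  forall A, measurable A -> P (array X @^-1` A) = P (array Y @^-1` A).
Proof.
move=> XY A mA.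
pose X' : {RV P >-> #|I|.-tuple R} :=
  HB.pack (array X) (isMeasurableFun.Build _ _ _ _ (array X) (measurable_array X)).
pose Y' : {RV P >-> #|I|.-tuple R} :=
  HB.pack (array Y) (isMeasurableFun.Build _ _ _ _ (array Y) (measurable_array Y)).
apply: (@tuple_law_unique _ _ _ _ (distribution P X') (distribution P Y')) => //.
  exact: le_lt_trans (probability_le1 (distribution P X') measurableT) (ltry _).
move=> B mB; rewrite /distribution /pushforward.
have E Z : array Z @^-1` box B = [set w | forall i, B (enum_rank i) (Z i w)].
  apply/seteqP; split => w /= Bw i.
    by have := Bw (enum_rank i); rewrite tnth_mktuple enum_rankK.
  by have := Bw (enum_val i); rewrite tnth_mktuple enum_valK.
rewrite [LHS](congr1 P (E X)) [RHS](congr1 P (E Y)).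
by apply: (XY (fun i => B (enum_rank i))) => i; exact: mB.
Qed.

(** The event is the preimage of one measurable set of arrays, so agreement on boxes suffices. [C]
    selects the pairs compared, later those within a column. *)
Lemma comparison_law X Y (C : rel I) (c : I -> I -> bool) :
  (forall B : I -> set R, (forall i, measurable (B i)) ->
    P [set w | forall i, B i (X i w)] = P [set w | forall i, B i (Y i w)]) ->
  P [set w | forall i j, C i j -> (X i w <= X j w) = c i j] =
  P [set w | forall i j, C i j -> (Y i w <= Y j w) = c i j].
Proof.
move=> XY.
pose A : set (#|I|.-tuple R) := [set t | forall i j, C i j ->
  (tnth t (enum_rank i) <= tnth t (enum_rank j)) = c i j].
have mA : measurable A.
  suff mC i j : measurable [set t : #|I|.-tuple R | C i j ->
      (tnth t (enum_rank i) <= tnth t (enum_rank j)) = c i j].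
    exact: (measurable_forall (fun i => measurable_forall (mC i))).
  case: (C i j); last by rewrite (_ : [set x | _] = setT) //; apply/seteqP; split.
  rewrite (_ : [set x | _] = (fun t : #|I|.-tuple R =>
      tnth t (enum_rank i) <= tnth t (enum_rank j)) @^-1` [set c i j]); last first.
    by apply/seteqP; split => t /= => [/(_ isT)|->].
  rewrite -[X in measurable X]setTI.
  by apply: measurable_fun_ler => //; exact: measurable_tnth.
have E (Z : I -> {RV P >-> R}) :
    [set w | forall i j, C i j -> (Z i w <= Z j w) = c i j] = array Z @^-1` A.
  by apply/seteqP; split => w /= H i j /(H i j); rewrite !tnth_mktuple !enum_rankK.
by rewrite !E; exact: array_law.
Qed.
End array_law.

(** * Absence of ties *)

Section no_ties.
Context d d0 (T : measurableType d) (T0 : measurableType d0) (R : realType)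
  (P : probability T R) (P0 : probability T0 R).

(** The mass at [r] is at most the increment of the distribution function over [(s, r]], which is
    arbitrarily small for [s] close to [r]. *)
Lemma cdf_continuous_atomless (X : {RV P0 >-> R}) (r : R) :
  continuous (cdf X) -> P0 (X @^-1` [set r]) = 0%E.
Proof.
move=> Xc; apply/eqP; rewrite eq_le measure_ge0 andbT; apply/lee_addgt0Pr => e e0.
rewrite add0e.
have cf s : cdf X s \is a fin_num by rewrite /cdf fin_num_measure.
have : fine (cdf X s) @[s --> r] --> fine (cdf X r).
  by apply: fine_cvg; rewrite fineK //; exact: Xc.
move=> /cvgrPdist_lt/(_ _ e0) [eta /= eta0 H].
have : `|fine (cdf X r) - fine (cdf X (r - eta / 2))| < e.
  apply: H; rewrite /= opprB addrC subrK gtr0_norm ?divr_gt0//.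
  by rewrite ltr_pdivrMr // ltr_pMr // ltr1n.
move=> /(le_lt_trans (ler_norm _)) cdfe.
set s := r - eta / 2 in cdfe.
have sr : s < r by rewrite /s ltrBlDr ltrDl divr_gt0.
have mX A : measurable A -> measurable (X @^-1` A).
  by move=> mA; rewrite -[X in measurable X]setTI; exact: (measurable_funPT X).
have m1 : measurable (X @^-1` [set r]) by exact: mX.
have m2 a : measurable (X @^-1` `]-oo, a]) by exact: mX.
have dis : X @^-1` [set r] `&` X @^-1` `]-oo, s] = set0.
  apply/seteqP; split => w // [/= ->]; rewrite in_itv /= => rs.
  by have := lt_le_trans sr rs; rewrite ltxx.
have le : (P0 (X @^-1` [set r]) + cdf X s <= cdf X r)%E.
  rewrite /cdf /distribution /pushforward -(measureU _ m1 (m2 s) dis).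
  apply: le_measure; rewrite ?inE; [exact: measurableU|exact: m2|].
  move=> w [/= ->|/=]; rewrite !in_itv /= ?lexx // => /le_trans; apply.
  exact: ltW.
have pf : P0 (X @^-1` [set r]) \is a fin_num by rewrite fin_num_measure.
rewrite -(fineK pf) lee_fin; apply: ltW; apply: le_lt_trans cdfe.
by rewrite lerBrDr -lee_fin EFinD !fineK.
Qed.

(** By independence the pair has the product law, and the sections of the diagonal are singletons,
    null for the law of [Y]. *)
Lemma independent_tie (X Y : {RV P >-> R}) :
  (forall A B, measurable A -> measurable B ->
     P (X @^-1` A `&` Y @^-1` B) = (P (X @^-1` A) * P (Y @^-1` B))%E) ->
  (forall r, P (Y @^-1` [set r]) = 0%E) ->
  P [set w | X w = Y w] = 0%E.
Proof.
move=> XY Y0.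
have mXY : measurable_fun setT (fun w => (X w, Y w)).
  by apply: measurable_fun_pair; exact: measurable_funPT.
pose XY' : {RV P >-> (R * R)%type} :=
  HB.pack (fun w => (X w, Y w)) (isMeasurableFun.Build _ _ _ _ _ mXY).
pose D : set (R * R) := [set z | z.1 = z.2].
have mD : measurable D.
  rewrite (_ : D = (fun z : R * R => z.1 == z.2) @^-1` [set true]); last first.
    by apply/seteqP; split => -[x y] /= /eqP.
  rewrite -[X in measurable X]setTI.
  by apply: measurable_fun_eqr.
have -> : [set w | X w = Y w] = XY' @^-1` D by [].
have := @product_measure_unique _ _ _ _ R (distribution P X) (distribution P Y)
  (distribution P XY') _ _ mD.
rewrite -[P _]/(distribution P XY' D) => <-; last first.
  by move=> A B mA mB; rewrite /distribution /pushforward -XY.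
rewrite /product_measure1 /=.
rewrite integral0_eq // => x _ /=.
rewrite (_ : xsection D x = [set x]); first exact: Y0.
by apply/seteqP; split => y; rewrite /xsection /= inE /D /= => ->.
Qed.
End no_ties.

Lemma expectation_finite d (T : measurableType d) (R : realType) (P : probability T R)
    (I : finType) (Q : T -> I) (a : I -> R) :
  (forall c, measurable (Q @^-1` [set c])) ->
  ('E_P[a \o Q] = \sum_c (a c)%:E * P (Q @^-1` [set c]))%E.
Proof.
move=> mQ.
have iL A : measurable A -> \1_A \in Lfun P 1.
  move=> mA; apply/Lfun1_integrable; apply/integrableP; split.
    by apply/measurable_EFinP; exact: measurable_indic.
  under eq_integral do rewrite /= ger0_norm //.
  by rewrite integral_indic // setIT; exact: le_lt_trans (probability_le1 _ mA) (ltry _).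
have -> : a \o Q = \sum_(g <- [seq a c \o* \1_(Q @^-1` [set c]) | c <- enum I]) g.
  apply/funext => w; rewrite big_map fct_sumE big_enum /= (bigD1 (Q w)) //= big1.
    by rewrite addr0 indicE mem_set ?mul1r.
  by move=> c cQ; rewrite indicE memNset ?mul0r // => /= Qc; rewrite -Qc eqxx in cQ.
rewrite expectation_sum; last first.
  by move=> g /mapP[c _ ->]; apply: Lfun_scale => //; exact: iL.
rewrite big_map big_enum /=; apply: eq_bigr => c _.
by rewrite expectationZl ?iL // expectation_indic.
Qed.

Lemma perm_card_lt n (s : 'S_n) i : #|[pred j | (s j < s i)%N]| = s i.
Proof.
rewrite -sum1_card; transitivity (\sum_(x < n | (x < s i)%N) 1)%N.
  by rewrite [RHS](reindex_inj (@perm_inj _ s)).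
by rewrite -(big_ord_widen n (fun=> 1%N) (ltnW (ltn_ord (s i)))) sum1_card card_ord.
Qed.

(** * Order patterns of the columns and their law *)

Section uniform_ranks.
Context (R : realType) (d d0 : measure_display)
    (T : measurableType d) (T0 : measurableType d0)
    (P : probability T R) (P0 : probability T0 R) (n p : nat)
    (X : 'I_p -> {RV P0 >-> R}) (S : 'I_n -> 'I_p -> {RV P >-> R})
    (X_indep : mutually_independent P0 (fun k => X k : T0 -> R))
    (X_cont : forall k, continuous (cdf (X k)))
    (S_iid : iid_copies S X).

Lemma rvec_box (T1 : Type) (Y : 'I_p -> T1 -> R) (A : 'I_p -> set R) :
  rvec Y @^-1` box A = [set w | forall k, A k (Y k w)].
Proof.
by apply/seteqP; split => w /= H k; have := H k; rewrite tnth_mktuple.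
Qed.

Lemma array_prob (A : 'I_n -> 'I_p -> set R) : (forall i k, measurable (A i k)) ->
  P [set w | forall i k, A i k (S i k w)] = (\prod_i \prod_k P0 (X k @^-1` A i k))%E.
Proof.
move=> mA; have [ind idd] := S_iid.
have := ind [set: 'I_n]%SET (fun i => box (A i)) (fun i => measurable_box (mA i)).
have -> : [set w | forall i, i \in [set: 'I_n]%SET -> box (A i) (rvec (S i) w)] =
   [set w | forall i k, A i k (S i k w)].
  apply/seteqP; split => w /= H i.
    by move=> k; have := H i (finset.in_setT i) k; rewrite tnth_mktuple.
  by move=> _ k; rewrite tnth_mktuple.
move=> ->; transitivity (\prod_(i in [set: 'I_n]%SET) \prod_k P0 (X k @^-1` A i k))%E; last first.
  by apply: eq_bigl => i; rewrite finset.in_setT.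
apply: eq_bigr => i _.
have := idd i (box (A i)) (measurable_box (mA i)).
rewrite !rvec_box => ->.
have -> : [set w | forall k, A i k (X k w)] =
    [set w | forall k, k \in [set: 'I_p]%SET -> A i k (X k w)].
  by apply/seteqP; split => w /= H k => [_|]; apply: H; rewrite ?finset.in_setT.
rewrite (X_indep [set: 'I_p]%SET (mA i)).
by apply: eq_bigl => k; rewrite finset.in_setT.
Qed.

(** The probability of a box is a product of marginals that depend on the column only, so permuting
    inside a column reindexes the product. *)
Lemma array_prob_perm (s : 'I_p -> 'S_n) (A : 'I_n * 'I_p -> set R) :
  (forall x, measurable (A x)) ->
  P [set w | forall x, A x (S x.1 x.2 w)] =
  P [set w | forall x, A x (S (s x.2 x.1) x.2 w)].
Proof.
move=> mA.
have -> : [set w | forall x, A x (S x.1 x.2 w)] =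
    [set w | forall i k, A (i, k) (S i k w)].
  by apply/seteqP; split => w /= H => [i k|[i k]]; [exact: (H (i, k))|exact: H].
have -> : [set w | forall x, A x (S (s x.2 x.1) x.2 w)] =
    [set w | forall i k, A (((s k)^-1)%g i, k) (S i k w)].
  apply/seteqP; split => w /= H => [i k|[i k]].
    by have := H (((s k)^-1)%g i, k); rewrite /= permKV.
  by have := H (s k i) k; rewrite permK.
rewrite (array_prob (A := fun i k => A (i, k))) //.
rewrite (array_prob (A := fun i k => A (((s k)^-1)%g i, k))) //.
rewrite exchange_big [RHS]exchange_big /=; apply: eq_bigr => k _.
exact: (reindex_inj (@perm_inj _ (s k)^-1%g)).
Qed.

Lemma tie_null i j k : i != j -> P [set w | S i k w = S j k w] = 0%E.
Proof.
move=> ij.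
have one (i0 : 'I_n) (A : set R) : measurable A ->
    P (S i0 k @^-1` A) = P0 (X k @^-1` A).
  move=> mA; have [_ idd] := S_iid.
  have := idd i0 (box (fun l => if l == k then A else setT)).
  rewrite !rvec_box => H.
  have E (T1 : Type) (Y : 'I_p -> T1 -> R) :
      [set w | forall l, (if l == k then A else setT) (Y l w)] = Y k @^-1` A.
    apply/seteqP; split => w /=; first by move=> /(_ k); rewrite eqxx.
    by move=> Aw l; case: eqP => // ->.
  rewrite -(E _ (fun k w => S i0 k w)) -(E _ (fun k w => X k w)) H //.
  by apply: measurable_box => l; case: ifP.
apply: independent_tie => [A B mA mB|r]; last first.
  by rewrite one //; apply: cdf_continuous_atomless.
have [ind _] := S_iid.
pose C (i0 : 'I_n) := if i0 == i then box (fun l => if l == k then A else setT)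
   else box (fun l => if l == k then B else setT).
have mC i0 : measurable (C i0).
  by rewrite /C; case: ifP => _; apply: measurable_box => l; case: ifP.
have E (i0 : 'I_n) (A0 : set R) :
   rvec (S i0) @^-1` box (fun l => if l == k then A0 else setT) = S i0 k @^-1` A0.
  rewrite rvec_box; apply/seteqP; split => w /=; first by move=> /(_ k); rewrite eqxx.
  by move=> Aw l; case: eqP => // ->.
have ji : j == i = false by rewrite eq_sym (negbTE ij).
have := ind [set i; j]%SET C mC.
rewrite big_setU1 ?big_set1 ?inE //= /C eqxx ji !E => <-; congr (P _).
apply/seteqP; split => w /=.
  move=> [Aw Bw] i0; rewrite !inE => /orP[/eqP->|/eqP->].
    by rewrite eqxx -[box _ _]/((rvec (S i) @^-1` box _) w) E.
  by rewrite ji -[box _ _]/((rvec (S j) @^-1` box _) w) E.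
move=> H; split.
  by have := H i; rewrite !inE eqxx => /(_ isT); rewrite -[box _ _]/((rvec (S i) @^-1` box _) w) E.
by have := H j; rewrite !inE eqxx orbT ji => /(_ isT); rewrite -[box _ _]/((rvec (S j) @^-1` box _) w) E.
Qed.

(** A random element with finitely many values that determines every [xi_hat], ties included; it
    reduces expectations to finite sums. *)
Definition comparisons (w : T) : {ffun 'I_n * 'I_n * 'I_p -> bool} :=
  [ffun x => S x.1.1 x.2 w <= S x.1.2 x.2 w].

Definition order_of (s : {ffun 'I_p -> 'S_n}) : {ffun 'I_n * 'I_n * 'I_p -> bool} :=
  [ffun x => (s x.2 x.1.1 <= s x.2 x.1.2)%N].

Lemma order_of_inj : injective order_of.
Proof.
move=> s t st; apply/ffunP => k; apply/permP => i; apply: val_inj.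
rewrite -[LHS]perm_card_lt -[RHS]perm_card_lt; apply: eq_card => j.
rewrite !inE !ltnNge; congr negb.
by have /ffunP/(_ (i, j, k)) := st; rewrite !ffunE.
Qed.

Lemma comparisonsP w s : comparisons w = order_of s <->
  forall k i j, (S i k w <= S j k w) = (s k i <= s k j)%N.
Proof.
split=> [/ffunP H k i j|H]; first by have := H (i, j, k); rewrite !ffunE.
by apply/ffunP => -[[i j] k]; rewrite !ffunE.
Qed.

Lemma measurable_comparisons c : measurable (comparisons @^-1` [set c]).
Proof.
rewrite (_ : _ @^-1` _ = [set w | forall x, (S x.1.1 x.2 w <= S x.1.2 x.2 w) = c x]).
  suff mx x : measurable [set w | (S x.1.1 x.2 w <= S x.1.2 x.2 w) = c x].
    exact: measurable_forall mx.
  rewrite -[X in measurable X]setTI.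
  rewrite (_ : [set w | _] = (fun w => S x.1.1 x.2 w <= S x.1.2 x.2 w) @^-1` [set c x]) //.
  by apply: measurable_fun_ler.
by apply/seteqP; split => w /= => [<- x|H]; [|apply/ffunP => x]; rewrite !ffunE.
Qed.

Definition rank_perm_fun w k (i : 'I_n) : nat := #|[pred j | S j k w < S i k w]|.

(* If such a pattern occurs at all, it contains a tie, always between the same two
   entries. *)
Lemma comparisons_null c : (forall s, c != order_of s) ->
  P (comparisons @^-1` [set c]) = 0%E.
Proof.
move=> cs; apply/eqP; rewrite eq_le measure_ge0 andbT.
have [[w /= Qw]|] := pselect (exists w, comparisons w = c); last first.
  move=> nex; rewrite (_ : _ @^-1` _ = set0) ?measure0 //.
  by apply/seteqP; split => w //= Qw; case: nex; exists w.
have [[k [i [j [ij tie]]]]|notie] := pselect (exists k i j, i != j /\ S i k w = S j k w).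
  rewrite -(tie_null k ij); apply: le_measure; rewrite ?inE.
  - exact: measurable_comparisons.
  - rewrite (_ : [set w | _] = (fun w => S i k w == S j k w) @^-1` [set true]); last first.
      by apply/seteqP; split => v /= /eqP.
    rewrite -[X in measurable X]setTI.
    by apply: measurable_fun_eqr.
  - move=> v /= Qv; apply/eqP; rewrite eq_le.
    have : comparisons v = comparisons w by rewrite Qv.
    move=> /ffunP H; have := H (i, j, k); have := H (j, i, k); rewrite !ffunE /=.
    by rewrite tie lexx => -> ->.
(* Without ties, counting the smaller entries of a column gives a permutation, and the pattern is
   [order_of] of these permutations. *)
exfalso.
have lt_n k i : (rank_perm_fun w k i < n)%N.
  rewrite -[X in (_ < X)%N](card_ord n); apply: proper_card; apply/fintype.properP.
  by split; [exact/fintype.subsetP|exists i; rewrite ?inE ?ltxx].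
have inj k : injective (fun i => Ordinal (lt_n k i)).
  move=> i j /(congr1 val) /= ranks; apply/eqP; apply: contraPT ranks => ij.
  suff mono a b : S a k w < S b k w -> (rank_perm_fun w k a < rank_perm_fun w k b)%N.
    case: (ltgtP (S i k w) (S j k w)) => [/mono|/mono|tie].
    - by move=> + e; rewrite e ltnn.
    - by move=> + e; rewrite e ltnn.
    - by case: notie; exists k, i, j.
  move=> ab; apply: proper_card; apply/fintype.properP; split.
    by apply/fintype.subsetP => x; rewrite !inE => /lt_trans; apply.
  by exists a; rewrite !inE ?ltxx.
pose s : {ffun 'I_p -> 'S_n} := [ffun k => perm (@inj k)].
have /eqP := cs s; apply; rewrite -Qw; apply/comparisonsP => k i j.
rewrite ffunE !permE /= leqNgt leNgt; congr negb.
apply/idP/idP => [ab|].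
  apply: proper_card; apply/fintype.properP; split.
    by apply/fintype.subsetP => x; rewrite !inE => /lt_trans; apply.
  by exists j; rewrite !inE ?ltxx.
rewrite ltNge; apply: contraTN => ba; rewrite -leqNgt; apply: subset_leq_card.
by apply/fintype.subsetP => x; rewrite !inE => /lt_le_trans; apply.
Qed.

(** The pattern of [t] is the identity pattern of the array whose column [k] is permuted by
    [(t k)^-1], an array with the same law. *)
Lemma order_prob_eq s : P (comparisons @^-1` [set order_of s]) =
  P (comparisons @^-1` [set order_of [ffun=> 1%g]]).
Proof.
pose C (x y : 'I_n * 'I_p) := x.2 == y.2.
pose c (x y : 'I_n * 'I_p) := (x.1 <= y.1)%N.
have E (t : {ffun 'I_p -> 'S_n}) : comparisons @^-1` [set order_of t] =
   [set w | forall x y, C x y ->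
     (S (((t x.2)^-1)%g x.1) x.2 w <= S (((t y.2)^-1)%g y.1) y.2 w) = c x y].
  apply/seteqP; split => w /=.
    move=> /comparisonsP H [i k] [j l] /eqP /= <-.
    by rewrite H !permKV.
  move=> H; apply/comparisonsP => k i j.
  by have := H (t k i, k) (t k j, k) (eqxx _); rewrite /= !permK.
rewrite !E.
have A (t : {ffun 'I_p -> 'S_n}) := @comparison_law _ _ _ P _ (fun x => S x.1 x.2)
  (fun x => S (((t x.2)^-1)%g x.1) x.2) C c (array_prob_perm (fun k => (t k)^-1)%g).
by rewrite -A -A.
Qed.

(** All other patterns are null, so the mass 1 is shared equally among these. *)
Lemma order_prob s :
  P (comparisons @^-1` [set order_of s]) = (#|{ffun 'I_p -> 'S_n}|%:R^-1)%:E.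
Proof.
set M := #|{ffun 'I_p -> 'S_n}|.
pose q := fine (P (comparisons @^-1` [set order_of s])).
have qE t : P (comparisons @^-1` [set order_of t]) = q%:E.
  rewrite order_prob_eq -(order_prob_eq s) /q fineK //.
  by rewrite fin_num_measure //; exact: measurable_comparisons.
suff : M%:R * q = 1.
  have M0 : M%:R != 0 :> R by rewrite pnatr_eq0 -lt0n; apply/card_gt0P; exists s.
  by rewrite qE => Mq; congr (_%:E); apply: (mulfI M0); rewrite Mq mulfV.
have := @expectation_finite _ _ _ P _ comparisons (fun=> 1) measurable_comparisons.
rewrite (_ : _ \o _ = cst 1) // expectation_cst.
rewrite (bigID (mem [set order_of t | t in [set: {ffun 'I_p -> 'S_n}]]%SET)) /=.
rewrite [X in (_ + X)%E]big1 ?adde0; last first.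
  move=> e ne; rewrite comparisons_null ?mule0 // => t.
  by apply: contraNN ne => /eqP ->; apply: imset_f.
rewrite big_imset /=; last by move=> ? ? _ _; exact: order_of_inj.
under eq_bigr do rewrite mul1e qE.
by rewrite sumEFin => -[]; rewrite sumr_const cardsT mulr_natl => <-.
Qed.

Theorem expectation_ranks (f : T -> R) (h : {ffun 'I_p -> 'S_n} -> R) :
  (forall w w', comparisons w = comparisons w' -> f w = f w') ->
  (forall w s, comparisons w = order_of s -> f w = h s) ->
  ('E_P[f] = ((\sum_s h s) / #|{ffun 'I_p -> 'S_n}|%:R)%:E)%E.
Proof.
move=> fQ fh.
(* [f] factors through the pattern; 0 is a dummy value at patterns that never occur. *)
pose a c := if pselect (exists w, comparisons w = c) is left H then f (projT1 (cid H)) else 0.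
have fa : f = a \o comparisons.
  apply/funext => w; rewrite /= /a; case: pselect => [H|]; last by case; exists w.
  by apply: fQ; case: cid.
rewrite fa (expectation_finite P a measurable_comparisons).
rewrite (bigID (mem [set order_of t | t in [set: {ffun 'I_p -> 'S_n}]]%SET)) /=.
rewrite [X in (_ + X)%E]big1 ?adde0; last first.
  move=> e ne; rewrite comparisons_null ?mule0 // => t.
  by apply: contraNN ne => /eqP ->; apply: imset_f.
rewrite big_imset /=; last by move=> ? ? _ _; exact: order_of_inj.
rewrite mulr_suml -sumEFin; apply: eq_big => [s|s _]; first by rewrite finset.in_setT.
rewrite order_prob EFinM; congr (_%:E * _)%E.
rewrite /a; case: pselect => [H|nex]; first by apply: fh; case: cid.
(* A pattern of positive probability does occur. *)
exfalso; have := order_prob s; rewrite (_ : _ @^-1` _ = set0); last first.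
  by apply/seteqP; split => w //= Qw; case: nex; exists w.
rewrite measure0 => -[] /esym /eqP; rewrite invr_eq0 pnatr_eq0 -leqn0 leqNgt.
by have -> : (0 < #|{ffun 'I_p -> 'S_n}|)%N by apply/card_gt0P; exists s.
Qed.
End uniform_ranks.

(** * Chatterjee's correlation as a function of the relative permutation *)

Lemma natr_dist (R : numDomainType) (a b : nat) :
  ((b - a) + (a - b))%N%:R = `|b%:R - a%:R| :> R.
Proof.
wlog ab : a b / (a <= b)%N => [H|].
  by case: (leqP a b) => [/H //|/ltnW /H E]; rewrite addnC E distrC.
have -> : (a - b = 0)%N by lia.
by rewrite addn0 natrB // ger0_norm // subr_ge0 ler_nat.
Qed.

Lemma total_jump_consecutive n (t : 'S_n.+1) :
  total_jump t =
  (\sum_(0 <= i < n) ((perm_nat t i.+1 - perm_nat t i) + (perm_nat t i - perm_nat t i.+1)))%N.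
Proof.
pose G a b : nat := ((perm_nat t b - perm_nat t a) + (perm_nat t a - perm_nat t b))%N.
transitivity (\sum_(a < n.+1) if (a < n)%N then G a a.+1 else 0)%N.
  apply: eq_bigr => a _.
  transitivity (\sum_(b < n.+1) if (b == a.+1 :> nat) then G a b else 0)%N.
    apply: eq_bigr => b _; rewrite /G !perm_nat_ord.
    by case: eqP => _; rewrite ?mul1n ?mul0n.
  rewrite -(big_mkord predT (fun b => if b == a.+1 then G a b else 0%N)) -big_mkcond.
  by rewrite big_nat1_eq ltnS /=.
rewrite big_ord_recr /= ltnn addn0 big_mkord; apply: eq_bigr => a _.
by rewrite /= ltn_ord.
Qed.

Lemma sorted_indices_perm (R : realType) n (x : 'I_n -> R) (a : 'S_n) :
  (forall i j, (x i <= x j) = (a i <= a j)%N) ->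
  sorted_indices x = [seq (a^-1)%g i | i <- enum 'I_n].
Proof.
move=> xa; rewrite /sorted_indices.
apply: (@sorted_eq _ (fun i j => x i <= x j)).
- by move=> j i k /=; apply: le_trans.
- move=> i j; rewrite !xa => aij; apply: (@perm_inj _ a).
  by apply: val_inj; apply/eqP; rewrite eqn_leq.
- by apply: sort_sorted => i j; exact: le_total.
- rewrite sorted_map; have : sorted leq (map val (enum 'I_n)) by rewrite val_enum_ord iota_sorted.
  rewrite sorted_map; apply: sub_sorted => i j /=.
  by rewrite xa !permKV.
- have uI : uniq (enum 'I_n) by exact: enum_uniq.
  rewrite perm_sort; apply: uniq_perm => //; first by rewrite (map_inj_uniq (@perm_inj _ _)).
  move=> i; rewrite mem_enum inE; apply/esym/mapP; exists (a i); rewrite ?mem_enum //.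
  by rewrite permK.
Qed.

Lemma rank_of_perm (R : realType) n (y : 'I_n -> R) (b : 'S_n) i :
  (forall i j, (y i <= y j) = (b i <= b j)%N) -> rank_of y i = (b i).+1.
Proof.
move=> yb; rewrite /rank_of (cardD1 i) inE lexx add1n; congr S.
rewrite -perm_card_lt; apply: eq_card => j; rewrite !inE yb ltn_neqAle; congr andb.
by rewrite -(inj_eq (@perm_inj _ b)) -val_eqE.
Qed.

Definition xi_perm (R : realType) n (t : 'S_n) : R :=
  1 - 3 * jump t / (n%:R ^+ 2 - 1).

(** Sorting by [x] lists the indices along [a^-1], so the concomitant ranks are the values of
    [a^-1 * b], where the left factor acts first. They count from 1, a shift that cancels in
    differences. *)
Lemma chatterjee_perm (R : realType) n (x y : 'I_n -> R) (a b : 'S_n) :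
  (forall i j, (x i <= x j) = (a i <= a j)%N) ->
  (forall i j, (y i <= y j) = (b i <= b j)%N) ->
  (0 < n)%N -> chatterjee x y = xi_perm R (a^-1 * b)%g.
Proof.
case: n x y a b => // n x y a b xa yb _; rewrite /chatterjee /xi_perm.
congr (1 - 3 * _ / _); rewrite /jump total_jump_consecutive natr_sum /=.
apply: eq_big_nat => i /andP[_ ilt].
have E j : (j < n.+1)%N -> nth 0%N (concomitant_ranks x y) j = (perm_nat (a^-1 * b)%g j).+1.
  move=> jn; rewrite /concomitant_ranks (sorted_indices_perm xa) -map_comp.
  rewrite (nth_map (Ordinal jn)) ?size_enum_ord //= (rank_of_perm _ yb).
  have -> : nth (Ordinal jn) (enum 'I_n.+1) j = Ordinal jn.
    by apply: val_inj; rewrite /= nth_enum_ord.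
  by rewrite -permM -(perm_nat_ord _ (Ordinal jn)).
rewrite !E; [|lia|lia]; rewrite natr_dist; congr `| _ |.
by rewrite -!natr1; ring.
Qed.

Lemma chatterjee_ext (R : realType) n (x y x' y' : 'I_n -> R) :
  (forall i j, (x i <= x j) = (x' i <= x' j)) ->
  (forall i j, (y i <= y j) = (y' i <= y' j)) ->
  chatterjee x y = chatterjee x' y'.
Proof.
move=> xx yy; rewrite /chatterjee.
suff -> : concomitant_ranks x y = concomitant_ranks x' y' by [].
rewrite /concomitant_ranks.
have -> : sorted_indices x = sorted_indices x'.
  by congr sort; apply/funext => i; apply/funext => j; exact: xx.
by apply: eq_map => i; apply: eq_card => j; rewrite !inE yy.
Qed.

(** * Averages over families of independent uniform permutations *)

Section ffun_mean.
Context (R : realType) (n p : nat).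
Local Notation ranks := {ffun 'I_p -> 'S_n}.
Implicit Type s : ranks.

Definition ranks_mean (h : ranks -> R) : R := (\sum_s h s) / #|{ffun 'I_p -> 'S_n}|%:R.

Lemma card_ranks_neq0 : #|{ffun 'I_p -> 'S_n}|%:R != 0 :> R.
Proof. by rewrite pnatr_eq0 -lt0n; apply/card_gt0P; exists [ffun=> 1%g]. Qed.

Lemma ranks_mean_cst c : ranks_mean (fun=> c) = c.
Proof. by rewrite /ranks_mean sumr_const -(mulr_natr c) mulfK // card_ranks_neq0. Qed.

Lemma ranks_mean_sum (I : finType) (Q : pred I) (h : I -> ranks -> R) :
  ranks_mean (fun s => \sum_(i | Q i) h i s) = \sum_(i | Q i) ranks_mean (h i).
Proof. by rewrite /ranks_mean exchange_big mulr_suml. Qed.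

Definition mul_at (b : 'I_p) (t : 'S_n) s : ranks :=
  [ffun k => if k == b then (s k * t)%g else s k].

Lemma mul_at_bij b t : bijective (mul_at b t).
Proof.
exists (mul_at b t^-1%g) => s; apply/ffunP => k; rewrite !ffunE;
  by case: eqP => // _; rewrite ?mulgK ?mulgKV.
Qed.

(* Right multiplication of one coordinate preserves the uniform distribution. *)
Lemma ranks_mean_average b (h : ranks -> R) :
  ranks_mean h = ranks_mean (fun s => perm_mean (fun t => h (mul_at b t s))).
Proof.
rewrite /ranks_mean /perm_mean -mulr_suml exchange_big /=; congr (_ / _).
have E t : \sum_s h (mul_at b t s) = \sum_s h s.
  by rewrite [RHS](reindex (mul_at b t)) //; exact: onW_bij (mul_at_bij b t).
transitivity ((\sum_(t : 'S_n) \sum_s h s) / n`!%:R); last first.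
  by congr (_ / _); apply: eq_bigr => t _; rewrite -(E t).
by rewrite sumr_const card_Sn -(mulr_natr (\sum_s h s)) mulfK // pnatr_eq0 -lt0n fact_gt0.
Qed.

(** With the other coordinates fixed, averaging over [s b] makes [(s a)^-1 * s b] uniform, while [F]
    stays constant. *)
Lemma ranks_mean_fresh a b (F : ranks -> R) (g : 'S_n -> R) : a != b ->
  (forall t s, F (mul_at b t s) = F s) ->
  ranks_mean (fun s => F s * g ((s a)^-1 * s b)%g) = ranks_mean F * perm_mean g.
Proof.
move=> ab Fb; rewrite (ranks_mean_average b).
rewrite {2}/ranks_mean mulrAC mulr_suml; congr (_ / _); apply: eq_bigr => s _.
rewrite /perm_mean mulrA; congr (_ / _); rewrite mulr_sumr.
rewrite [RHS](reindex_inj (mulgI ((s a)^-1 * s b)%g)); apply: eq_bigr => t _.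
by rewrite Fb !ffunE eqxx (negbTE ab) mulgA.
Qed.

Lemma ranks_mean_freshV a b (F : ranks -> R) (g : 'S_n -> R) : a != b ->
  (forall t s, F (mul_at b t s) = F s) ->
  ranks_mean (fun s => F s * g ((s b)^-1 * s a)%g) = ranks_mean F * perm_mean g.
Proof.
move=> ab Fb; rewrite -(perm_meanV g) -(ranks_mean_fresh _ ab Fb).
by congr ranks_mean; apply/funext => s; rewrite invMg invgK.
Qed.

Lemma ranks_mean_pair a b (g : 'S_n -> R) : a != b ->
  ranks_mean (fun s => g ((s a)^-1 * s b)%g) = perm_mean g.
Proof.
move=> ab; have := @ranks_mean_fresh a b (fun=> 1) g ab (fun _ _ => erefl).
by rewrite ranks_mean_cst mul1r => <-; congr ranks_mean; apply/funext => s; rewrite mul1r.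
Qed.

Lemma ranks_mean_disjoint k l a b (g : 'S_n -> R) : k != l -> a != b ->
  (a, b) != (k, l) -> (a, b) != (l, k) -> perm_mean g = 0 ->
  ranks_mean (fun s => g ((s k)^-1 * s l)%g * g ((s a)^-1 * s b)%g) = 0.
Proof.
move=> kl ab n1 n2 g0.
have [fresh|stale] := boolP ((b != k) && (b != l)).
  case/andP: fresh => bk bl; rewrite (ranks_mean_fresh _ ab) ?g0 ?mulr0 // => t s.
  by rewrite !ffunE ![_ == b]eq_sym (negbTE bk) (negbTE bl).
(* Now [b] is [k] or [l], so [a] is neither of them and becomes the free index. *)
have ba : b != a by rewrite eq_sym.
have [ak al] : a != k /\ a != l.
  move: stale n1 n2 ab; rewrite negb_and !negbK !xpair_eqE.
  by case/orP => /eqP->; rewrite eqxx ?andbT.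
rewrite (ranks_mean_freshV (a := b) (b := a)) ?g0 ?mulr0 // => t s.
by rewrite !ffunE ![_ == a]eq_sym (negbTE ak) (negbTE al).
Qed.

Lemma sum_offdiag (c : R) :
  \sum_(kl : 'I_p * 'I_p | kl.1 != kl.2) c = p%:R * (p%:R - 1) * c.
Proof.
transitivity (\sum_(k < p) \sum_(l < p | k != l) c).
  by rewrite pair_big_dep.
transitivity (\sum_(k < p) (p%:R - 1) * c).
  apply: eq_bigr => k _; rewrite sumr_const.
  have -> : #|[pred l | k != l]| = p.-1.
    by rewrite -[in RHS](card_ord p) -(cardC1 k); apply: eq_card => l; rewrite !inE eq_sym.
  have p0 : (0 < p)%N by case: (p) k => [[]|].
  by rewrite -subn1 -(mulr_natr c) natrB // mulrC.
by rewrite sumr_const card_ord -[LHS]mulr_natr; ring.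
Qed.

(** Against [(k, l)] only the pairs [(k, l)] and [(l, k)] survive in the double sum; the second one
    contributes the inverse permutation. *)
Lemma ranks_mean_square (g : 'S_n -> R) : perm_mean g = 0 ->
  ranks_mean (fun s => (\sum_(kl : 'I_p * 'I_p | kl.1 != kl.2) g ((s kl.1)^-1 * s kl.2)%g) ^+ 2)
  = p%:R * (p%:R - 1) * (perm_mean (fun t => g t ^+ 2) +
      perm_mean (fun t => g t * g t^-1%g)).
Proof.
move=> g0.
rewrite -sum_offdiag.
transitivity (ranks_mean (fun s => \sum_(kl : 'I_p * 'I_p | kl.1 != kl.2)
   \sum_(ab : 'I_p * 'I_p | ab.1 != ab.2)
     g ((s kl.1)^-1 * s kl.2)%g * g ((s ab.1)^-1 * s ab.2)%g)).
  by congr ranks_mean; apply/funext => s; rewrite expr2 big_distrlr.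
rewrite ranks_mean_sum; apply: eq_bigr => -[k l] /= kl.
have lk : l != k by rewrite eq_sym.
rewrite ranks_mean_sum (bigD1 (k, l)) //= (bigD1 (l, k)) /=; last first.
  by rewrite lk xpair_eqE (negbTE lk).
rewrite big1 ?addr0; last first.
  by move=> -[a b] /= /andP[/andP[ab n1] n2]; exact: ranks_mean_disjoint.
rewrite -(ranks_mean_pair _ kl) -(ranks_mean_pair (fun t => g t * g t^-1%g) kl).
congr (_ + _); congr ranks_mean; apply/funext => s; rewrite ?expr2 //.
by rewrite invMg invgK.
Qed.
End ffun_mean.

(** * Moments of the squared correlation *)

Section xi_moments.
Context {R : realType} {n : nat} (n_ge2 : (2 <= n)%N).
Implicit Type f g : 'S_n -> R.
Let N : R := n%:R.

Lemma perm_meanD f g : perm_mean (fun t => f t + g t) = perm_mean f + perm_mean g.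
Proof. by rewrite /perm_mean big_split mulrDl. Qed.
Lemma perm_meanZ c f : perm_mean (fun t => c * f t) = c * perm_mean f.
Proof. by rewrite /perm_mean -mulr_sumr mulrA. Qed.
Lemma perm_mean_cst c : perm_mean (fun _ : 'S_n => c) = c :> R.
Proof.
rewrite /perm_mean sumr_const card_Sn -(mulr_natr c) mulfK //.
Qed.

Lemma n_neq0 : N != 0.
Proof. by rewrite pnatr_eq0; case: n n_ge2. Qed.
Lemma nB1_neq0 : N - 1 != 0.
Proof. by rewrite subr_eq0 -[1]/(1%:R) eqr_nat; case: n n_ge2 => [|[]]. Qed.
Lemma nD1_neq0 : N + 1 != 0.
Proof. by rewrite natr1 pnatr_eq0. Qed.

Let q : R := 3 / (N ^+ 2 - 1).

Lemma xi_permE (t : 'S_n) : xi_perm R t = 1 - q * jump t.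
Proof. by rewrite /xi_perm /q mulrAC. Qed.

Definition xi2_mean : R := (N - 2) * (4 * N - 7) / (10 * (N - 1) ^+ 2 * (N + 1)).

Lemma qE : q = 3 / ((N - 1) * (N + 1)).
Proof. by rewrite /q; congr (_ / _); ring. Qed.

Lemma mean_xi2 : perm_mean (fun t : 'S_n => xi_perm R t ^+ 2) = xi2_mean.
Proof.
transitivity (perm_mean (fun t : 'S_n => 1 + ((- (2 * q)) * jump t + q ^+ 2 * jump t ^+ 2))).
  by congr perm_mean; apply/funext => t; rewrite xi_permE; ring.
rewrite !perm_meanD !perm_meanZ perm_mean_cst mean_jump // mean_jump2 // qE /xi2_mean -/N.
by field; rewrite ?nB1_neq0 ?nD1_neq0.
Qed.

Definition xi2_cov : R :=
  ((N - 2) * (784 * N ^+ 5 - (8 * 1000 + 22) * N ^+ 4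
                    + (27 * 1000 + 301) * N ^+ 3 - (24 * 1000 + 228) * N ^+ 2
                    - (5 * 1000 + 45) * N - (44 * 1000 + 70))
         / (50 * N * (N + 1) ^+ 4 * (N - 1) ^+ 5)).

Lemma mean_xi2_xi2V :
  perm_mean (fun t : 'S_n => xi_perm R t ^+ 2 * xi_perm R t^-1%g ^+ 2) = xi2_cov + xi2_mean ^+ 2.
Proof.
have V f : perm_mean (fun t => f t^-1%g) = perm_mean f by exact: perm_meanV.
(* Writing the last cubic term with [(t^-1)^-1] makes it the other cubic term at [t^-1], with the
   same mean. *)
transitivity (perm_mean (fun t : 'S_n => 1 + ((- (2 * q)) * jump t +
   ((- (2 * q)) * jump t^-1%g + (q ^+ 2 * jump t ^+ 2 + (q ^+ 2 * jump t^-1%g ^+ 2 +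
   (4 * q ^+ 2 * (jump t * jump t^-1%g) +
    ((- (2 * q ^+ 3)) * (jump t ^+ 2 * jump t^-1%g) +
    ((- (2 * q ^+ 3)) * (jump t^-1%g ^+ 2 * jump (t^-1)^-1%g) +
    q ^+ 4 * (jump t ^+ 2 * jump t^-1%g ^+ 2)))))))))).
  by congr perm_mean; apply/funext => t; rewrite !xi_permE invgK; ring.
rewrite !perm_meanD !perm_meanZ perm_mean_cst.
rewrite (V jump) (V (fun t => jump t ^+ 2)) (V (fun t => jump t ^+ 2 * jump t^-1%g)).
rewrite mean_jump // mean_jump2 // mean_jump11 // mean_jump21 // mean_jump22 //.
rewrite qE /xi2_mean /xi2_cov -/N.
by field; rewrite ?nB1_neq0 ?nD1_neq0 ?n_neq0.
Qed.

(** The contribution of one ordered pair to the variance of the statistic, variance plus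
    covariance. *)
Definition xi2_var_cov : R :=
  ((224 * N ^+ 8 - 1792 * N ^+ 7 + (15 * 1000 + 803) * N ^+ 6
                - (137 * 1000 + 437) * N ^+ 5 + (599 * 1000 + 321) * N ^+ 4
                - (1080 * 1000 + 523) * N ^+ 3 + (610 * 1000 + 212) * N ^+ 2
                - (493 * 1000 + 848) * N + (1233 * 1000 + 960))
               / (700 * N * (N + 1) ^+ 4 * (N - 1) ^+ 5)).

Lemma mean_xi4 : (4 <= n)%N ->
  perm_mean (fun t : 'S_n => xi_perm R t ^+ 4) = xi2_var_cov - xi2_cov + xi2_mean ^+ 2.
Proof.
move=> n4.
transitivity (perm_mean (fun t : 'S_n => 1 + ((- (4 * q)) * jump t +
   (6 * q ^+ 2 * jump t ^+ 2 + ((- (4 * q ^+ 3)) * jump t ^+ 3 + q ^+ 4 * jump t ^+ 4))))).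
  by congr perm_mean; apply/funext => t; rewrite xi_permE; ring.
rewrite !perm_meanD !perm_meanZ perm_mean_cst.
rewrite mean_jump // mean_jump2 // mean_jump3 // mean_jump4 //.
rewrite qE /xi2_mean /xi2_cov /xi2_var_cov -/N.
by field; rewrite ?nB1_neq0 ?nD1_neq0 ?n_neq0.
Qed.
End xi_moments.

(** * The statistic in terms of rank permutations *)

Section statistics.
Context (R : realType) (d : measure_display) (T : measurableType d)
  (P : probability T R) (n p : nat) (S : 'I_n -> 'I_p -> {RV P >-> R}).

Lemma xi_hat_ext w w' k l : comparisons S w = comparisons S w' ->
  xi_hat S k l w = xi_hat S k l w'.
Proof.
move=> /ffunP E; apply: chatterjee_ext => i j.
  by have := E (i, j, k); rewrite !ffunE.
by have := E (i, j, l); rewrite !ffunE.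
Qed.

Lemma xi_hat_order w s k l : (0 < n)%N -> comparisons S w = order_of s ->
  xi_hat S k l w = xi_perm R ((s k)^-1 * s l)%g.
Proof.
by move=> n0 /comparisonsP H; apply: chatterjee_perm => // i j; exact: H.
Qed.

End statistics.

(* Large coefficients are written a * 1000 + b because numerals are unary:
   8022, 27301, 24228, 5045, 44070 in the covariance and 15803, 137437, 599321,
   1080523, 610212, 493848, 1233960 in the variance. *)
Theorem lemma2p2 (R : realType) (d d0 : measure_display)
    (T : measurableType d) (T0 : measurableType d0)
    (P : probability T R) (P0 : probability T0 R) (n p : nat)
    (X : 'I_p -> {RV P0 >-> R}) (S : 'I_n -> 'I_p -> {RV P >-> R})
    (n_ge2 : (2 <= n)%N)
    (X_indep : mutually_independent P0 (fun k => X k : T0 -> R))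
    (X_cont : forall k, continuous (cdf (X k)))
    (S_iid : iid_copies S X) :
  let N : R := n%:R in
  let pp : R := p%:R * (p%:R - 1) in
  let u_n : R := (N - 2) * (4 * N - 7) / (10 * (N - 1) ^+ 2 * (N + 1)) in
  let xi2 (k l : 'I_p) : T -> R := xi_hat S k l ^+ 2 in
  let Tnp : T -> R := T_stat S in
  [/\ forall k l, k != l -> ('E_P[xi2 k l] = u_n%:E)%E,
      ('E_P[Tnp] = (pp * u_n)%:E)%E,
      forall k l, k != l ->
        covariance P (xi2 k l) (xi2 l k) =
        ((N - 2) * (784 * N ^+ 5 - (8 * 1000 + 22) * N ^+ 4
                    + (27 * 1000 + 301) * N ^+ 3 - (24 * 1000 + 228) * N ^+ 2
                    - (5 * 1000 + 45) * N - (44 * 1000 + 70))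
         / (50 * N * (N + 1) ^+ 4 * (N - 1) ^+ 5))%:E,
      forall k l, k != l ->
        'V_P[Tnp] = (pp%:E * 'V_P[xi2 k l]
                     + pp%:E * covariance P (xi2 k l) (xi2 l k))%E
    & (4 <= n)%N ->
        'V_P[Tnp] =
        (pp * ((224 * N ^+ 8 - 1792 * N ^+ 7 + (15 * 1000 + 803) * N ^+ 6
                - (137 * 1000 + 437) * N ^+ 5 + (599 * 1000 + 321) * N ^+ 4
                - (1080 * 1000 + 523) * N ^+ 3 + (610 * 1000 + 212) * N ^+ 2
                - (493 * 1000 + 848) * N + (1233 * 1000 + 960))
               / (700 * N * (N + 1) ^+ 4 * (N - 1) ^+ 5)))%:E].
Proof.
move=> N pp u_n xi2 Tnp.
have n0 : (0 < n)%N by exact: ltnW.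
have uE : @xi2_mean R n = u_n by [].
clearbody u_n.
pose G (t : 'S_n) : R := xi_perm R t ^+ 2.
(* Centring is what makes the terms of different unordered pairs orthogonal. *)
pose G0 (t : 'S_n) : R := G t - u_n.
have meanG : perm_mean G = u_n by rewrite -uE; exact: mean_xi2.
have meanG0 : perm_mean G0 = 0.
  transitivity (perm_mean (fun t => G t + (fun=> - u_n) t)); first by [].
  by rewrite perm_meanD perm_mean_cst meanG subrr.
have E (f : T -> R) (h : {ffun 'I_p -> 'S_n} -> R) :
    (forall w w', comparisons S w = comparisons S w' -> f w = f w') ->
    (forall w s, comparisons S w = order_of s -> f w = h s) ->
    ('E_P[f] = (ranks_mean h)%:E)%E.
  by move=> f1 f2; exact: (expectation_ranks X_indep X_cont S_iid f1 f2).
have xi2E k l w : xi2 k l w = xi_hat S k l w ^+ 2 by rewrite /xi2 !expr2.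
have xi2_ext k l w w' : comparisons S w = comparisons S w' -> xi2 k l w = xi2 k l w'.
  by move=> ww; rewrite !xi2E (xi_hat_ext k l ww).
have xi2_order k l w s : comparisons S w = order_of s -> xi2 k l w = G ((s k)^-1 * s l)%g.
  by move=> ws; rewrite xi2E (xi_hat_order k l n0 ws).
have meanX k l : k != l -> ('E_P[xi2 k l] = u_n%:E)%E.
  move=> kl; rewrite (E _ (fun s => G ((s k)^-1 * s l)%g)) //.
  - by rewrite ranks_mean_pair // meanG.
  - by move=> w w'; exact: xi2_ext.
  - by move=> w s; exact: xi2_order.
have T_order w s : comparisons S w = order_of s ->
    Tnp w = \sum_(kl : 'I_p * 'I_p | kl.1 != kl.2) G ((s kl.1)^-1 * s kl.2)%g.
  by move=> ws; apply: eq_bigr => kl _; rewrite -(xi2_order _ _ _ _ ws) xi2E.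
have T_ext w w' : comparisons S w = comparisons S w' -> Tnp w = Tnp w'.
  by move=> ww; apply: eq_bigr => kl _; rewrite -!xi2E; exact: xi2_ext.
have meanT : ('E_P[Tnp] = (pp * u_n)%:E)%E.
  rewrite (E _ _ T_ext T_order) ranks_mean_sum; congr (_%:E).
  by rewrite -sum_offdiag; apply: eq_bigr => kl klne; rewrite ranks_mean_pair.
have covX k l k' l' : k != l -> k' != l' ->
    covariance P (xi2 k l) (xi2 k' l') =
    (ranks_mean (fun s => G0 ((s k)^-1 * s l)%g * G0 ((s k')^-1 * s l')%g))%:E.
  move=> kl kl'; rewrite unlock !meanX //=; apply: E => [w w' ww|w s ws].
    rewrite -[LHS]/((xi2 k l w - u_n) * (xi2 k' l' w - u_n)).
    by rewrite (xi2_ext k l _ _ ww) (xi2_ext k' l' _ _ ww).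
  rewrite -[LHS]/((xi2 k l w - u_n) * (xi2 k' l' w - u_n)).
  by rewrite (xi2_order k l _ _ ws) (xi2_order k' l' _ _ ws).
have varX k l : k != l -> 'V_P[xi2 k l] = (perm_mean (fun t => G0 t ^+ 2))%:E.
  by move=> kl; rewrite /variance covX // -(ranks_mean_pair _ kl).
have covXV k l : k != l -> covariance P (xi2 k l) (xi2 l k) =
    (perm_mean (fun t => G0 t * G0 t^-1%g))%:E.
  move=> kl; rewrite covX //; last by rewrite eq_sym.
  rewrite -(ranks_mean_pair _ kl); congr (ranks_mean _)%:E.
  by apply/funext => s; rewrite invMg invgK.
(* Centring [Tnp] centres each of its terms, so the variance is the mean of the square of a sum of
   [G0] terms. *)
have varT : 'V_P[Tnp] =
    (pp * (perm_mean (fun t => G0 t ^+ 2) + perm_mean (fun t => G0 t * G0 t^-1%g)))%:E.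
  rewrite -(@ranks_mean_square R n p G0 meanG0) /variance unlock meanT /=.
  apply: E => [w w' ww|w s ws]; first by
    rewrite -[LHS]/((Tnp w - pp * u_n) * (Tnp w - pp * u_n)) (T_ext _ _ ww).
  rewrite -[LHS]/((Tnp w - pp * u_n) * (Tnp w - pp * u_n)) -expr2 (T_order _ _ ws).
  by rewrite -sum_offdiag -sumrB.
have sqG0 : perm_mean (fun t => G0 t ^+ 2) =
    perm_mean (fun t : 'S_n => xi_perm R t ^+ 4) - u_n ^+ 2.
  transitivity (perm_mean (fun t : 'S_n =>
    xi_perm R t ^+ 4 + ((- (2 * u_n)) * G t + (fun=> u_n ^+ 2) t))).
    by congr perm_mean; apply/funext => t; rewrite /G0 /G /=; ring.
  rewrite !perm_meanD perm_meanZ perm_mean_cst meanG; ring.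
have crossG0 : perm_mean (fun t => G0 t * G0 t^-1%g) = xi2_cov (n := n).
  transitivity (perm_mean (fun t : 'S_n => xi_perm R t ^+ 2 * xi_perm R t^-1%g ^+ 2 +
     ((- u_n) * G t + ((- u_n) * G t^-1%g + (fun=> u_n ^+ 2) t)))).
    by congr perm_mean; apply/funext => t; rewrite /G0 /G /=; ring.
  rewrite !perm_meanD !perm_meanZ perm_mean_cst (perm_meanV G) meanG.
  by rewrite mean_xi2_xi2V // uE; ring.
split => //.
- by move=> k l kl; rewrite covXV // crossG0.
- by move=> k l kl; rewrite varT varX // covXV // mulrDr EFinD !EFinM.
- by move=> n4; rewrite varT sqG0 crossG0 mean_xi4 // uE addrK subrK.
Qed.
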